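(* Let $f_i$ ($i\in\mathcal V$) satisfy the following assumptions (all notation is as in the context). (A1) For each $i\in\mathcal V$, $f_i$ is twice continuously differentiable and locally strongly convex, $f_i$ has a minimizer, and $\nabla^2 f_i$ is locally Lipschitz continuous. (A3) For each $i\in\mathcal V$, $x\mapsto f_i(x^* )-f_i(x)-\nabla f_i(x)^T(x^*-x)$ is coercive. Let $\mathbf x^k=[x_1^k;\ldots;x_N^k]$, $k\ge 0$, be generated by the DEAN iteration with $0<\alpha_{\{i,j\}}\le\bar\alpha$ and $g_{\{i,j\}}(x)=\frac12x^Tx$ for all $\{i,j\}\in\mathcal E$. Suppose that for every $\{i,j\}\in\mathcal E$, $$\alpha_{\{i,j\}}<\frac{1}{2\Gamma_{\{i,j\}}}\min\Bigl\{\frac{\theta_i^2}{|\mathcal N_i|}\Bigl(\Theta'_i-\frac{\theta'_i}{2}+\frac{L'_i}{2}\sqrt{\frac{2V(\mathbf x^0)}{\theta_i}}\Bigr)^{-1},\ \frac{\theta_j^2}{|\mathcal N_j|}\Bigl(\Theta'_j-\frac{\theta'_j}{2}+\frac{L'_j}{2}\sqrt{\frac{2V(\mathbf x^0)}{\theta_j}}\Bigr)^{-1}\Bigr\}$$ (where $\Gamma_{\{i,j\}}=1$) and $\alpha_{\{i,j\}}<\theta/(\max_{i\in\mathcal V}|\mathcal N_i|)$. Then there exists $\tilde{\mathbf x}=[\tilde x;\ldots;\tilde x]\in\mathbb R^{nN}$, $\tilde x\in\mathbb R^n$, such that, for all $k\ge0$, $$\|\mathbf x^k-\tilde{\mathbf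 x}\|\le\frac{\max_{\{i,j\}\in\mathcal E}\alpha_{\{i,j\}}\,\lambda_{\max}(L_{\mathcal G})}{\theta(1-q)}\|\mathbf x^0\|q^k,$$ where $$q=\max\Bigl\{\frac{\max_{\{i,j\}\in\mathcal E}\alpha_{\{i,j\}}\,\lambda_{\max}(L_{\mathcal G})}{\theta}-1,\ 1-\frac{\min_{\{i,j\}\in\mathcal E}\alpha_{\{i,j\}}\,\lambda_2(L_{\mathcal G})}{\Theta}\Bigr\}\in(0,1).$$ In addition, $$\|\tilde{\mathbf x}-\mathbf x^*\|\le\max_{i\in\mathcal V}\frac{L_i}{\tilde\rho_i}\cdot\frac{\sqrt N\,V(\mathbf x^0)}{2\sum_{i\in\mathcal V}\bar\theta_i},$$ where $\mathbf x^*=[x^*;\ldots;x^*]\in\mathbb R^{nN}$ and $$\tilde\rho_i=\frac{\theta_i^2}{2|\mathcal N_i|\max_{j\in\mathcal N_i}\alpha_{\{i,j\}}}+\frac{\theta_i}{2}-\Theta_i-\frac{L_i}{2}\sqrt{\frac{2V(\mathbf x^0)}{\theta_i}}>0,\quad\forall i\in\mathcal V.$$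
   Context: **Network and problem.** $\mathcal G=(\mathcal V,\mathcal E)$ is an undirected connected graph, $\mathcal V=\{1,\dots,N\}$, $N\ge2$, $\mathcal E\subseteq\{\{i,j\}:i,j\in\mathcal V,\ i\ne j\}$ (unordered pairs), and $\mathcal N_i=\{j\in\mathcal V:\{i,j\}\in\mathcal E\}$. $L_{\mathcal G}\in\mathbb R^{N\times N}$ is the graph Laplacian: $[L_{\mathcal G}]_{ii}=|\mathcal N_i|$, $[L_{\mathcal G}]_{ij}=-1$ if $\{i,j\}\in\mathcal E$, and $0$ otherwise. $\lambda_2(\cdot)$ and $\lambda_{\max}(\cdot)$ are the second smallest (counted with multiplicity) and the largest eigenvalue of a symmetric positive semidefinite matrix. Each node $i$ has a function $f_i:\mathbb R^n\to\mathbb R$. $\|\cdot\|$ is the Euclidean norm (for matrices, the induced spectral norm); $[z_1;\dots;z_N]\in\mathbb R^{nN}$ denotes stacking; $A\succeq B$ means $A-B$ is positive semidefinite; $\operatorname{conv}$ is the convex hull. A twice continuously differentiable $f:\mathbb R^n\to\mathbb R$ is *locally strongly convex* if for every convex compact set $\mathcal C$ there is $\theta_{\mathcal C}>0$ with $\nabla^2 f(x)\succeq\theta_{\mathcal C}I_n$ for all $x\in\mathcal C$. A vector- or matrix-valued function $h$ is *locally Lipschitz continuous* if for every compact $\mathcal C$ in its domain there is $L_{\mathcal C}\ge0$ with $\|h(x)-h(y)\|\le L_{\mathcal C}\|x-y\|$ for all $x,y\in\mathcal C$. Under assumption (A1), each $f_i$ has a unique minimizer $x_i^*\in\mathbb R^n$,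 and $\min_{x\in\mathbb R^n}\sum_{i\in\mathcal V}f_i(x)$ has a unique optimal solution $x^*$. **DEAN iteration.** Given symmetric link step-sizes $\alpha_{\{i,j\}}>0$ and link functions $g_{\{i,j\}}:\mathbb R^n\to\mathbb R$, set $x_i^0=x_i^*$ for all $i\in\mathcal V$ and, for $k\ge0$ and all $i\in\mathcal V$, $$x_i^{k+1}=x_i^k+(\nabla^2 f_i(x_i^k))^{-1}\sum_{j\in\mathcal N_i}\alpha_{\{i,j\}}\bigl(\nabla g_{\{i,j\}}(x_j^k)-\nabla g_{\{i,j\}}(x_i^k)\bigr).$$ **Lyapunov function.** For $\mathbf x=[x_1;\dots;x_N]\in\mathbb R^{nN}$, $V(\mathbf x)=\sum_{i\in\mathcal V}\bigl(f_i(x^* )-f_i(x_i)-\nabla f_i(x_i)^T(x^*-x_i)\bigr)$. **Constants.** With $\mathbf x^0=[x_1^*;\dots;x_N^*]$, let $\mathcal C_i=\{x\in\mathbb R^n: f_i(x^* )-f_i(x)-\nabla f_i(x)^T(x^*-x)\le V(\mathbf x^0)\}$, which is compact under (A3). Fix: - $\Theta_i,\theta_i\in(0,\infty)$ with $\Theta_iI_n\succeq\nabla^2 f_i(x)\succeq\theta_iI_n$ for all $x\in\operatorname{conv}\mathcal C_i$; put $\Theta=\max_{i\in\mathcal V}\Theta_i$ and $\theta=\min_{i\in\mathcal V}\theta_i$; - $L_i\in[0,\infty)$ a Lipschitz constant of $\nabla^2 f_i$ on $\operatorname{conv}\mathcal C_i$; - $\bar\Theta_i,\bar\theta_i\in(0,\infty)$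 with $\bar\Theta_iI_n\succeq\nabla^2 f_i(x)\succeq\bar\theta_iI_n$ for all $x\in\operatorname{conv}\bigcup_{j\in\mathcal V}\mathcal C_j$; - $\Gamma_{\{i,j\}}$, an upper bound on the eigenvalues of $\nabla^2 g_{\{i,j\}}$ on $\operatorname{conv}(\mathcal C_i\cup\mathcal C_j)$; here, since $g_{\{i,j\}}(x)=\frac12x^Tx$, $\Gamma_{\{i,j\}}=1$; - an arbitrary $\bar\alpha>0$, and $\delta_i=\frac{\bar\alpha}{\theta_i}\sum_{j\in\mathcal N_i}\Gamma_{\{i,j\}}\Bigl(\sqrt{2V(\mathbf x^0)/\theta_i}+\sqrt{2V(\mathbf x^0)/\theta_j}\Bigr)$; - $\mathcal C_i'=\operatorname{conv}\{x\in\mathbb R^n:\|x-y\|\le\delta_i \text{ for some } y\in\mathcal C_i\}$ (compact, containing $\operatorname{conv}\mathcal C_i$); - $\Theta_i',\theta_i'\in(0,\infty)$ with $\Theta_i'I_n\succeq\nabla^2 f_i(x)\succeq\theta_i'I_n$ for all $x\in\mathcal C_i'$, and $L_i'\in[0,\infty)$ a Lipschitz constant of $\nabla^2 f_i$ on $\mathcal C_i'$, where $\Theta_i'\ge\Theta_i$, $\theta_i'\le\theta_i$, $L_i'\ge L_i$.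
   Formalization: The claim q∈(0,1) is replaced by q<1 and either q>0, or q=0 with max α·λ_max(L_G)=θ and min α·λ_2(L_G)=Θ, since q=0 does occur (N=2, n=1, f_1=x²/2, f_2=(x−1)²/2, α=1/2); also n≥1 is assumed. *)

(* Defs.v *)
(* MathComp-Analysis: R^n is ['rV[R]_n] (row vectors) for [R : realType]. *)
From HB Require Import structures.
From mathcomp Require Import all_boot all_order all_algebra.
From mathcomp Require Import all_classical all_reals all_analysis.

Set Implicit Arguments.
Unset Strict Implicit.
Unset Printing Implicit Defensive.

Import Order.TTheory GRing.Theory Num.Theory.
Import numFieldNormedType.Exports.

Local Open Scope classical_set_scope.
Local Open Scope ring_scope.

(* Maximum and minimum of F over a nonempty finite set A (0 if A is empty). *)
Definition fmax (R : realType) (I : finType) (A : {set I}) (F : I -> R) : R :=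
  if [pick i in A] is Some i0 then \big[Num.max/F i0]_(i in A) F i else 0.

Definition fmin (R : realType) (I : finType) (A : {set I}) (F : I -> R) : R :=
  if [pick i in A] is Some i0 then \big[Num.min/F i0]_(i in A) F i else 0.

Lemma fmaxP (R : realType) (I : finType) (A : {set I}) (F : I -> R) :
  A != finset.set0 ->
  (exists2 i, i \in A & fmax A F = F i) /\ {in A, forall i, F i <= fmax A F}.
Proof.
rewrite /fmax; case: pickP => [i0 i0A _|A0]; last first.
  by case/finset.set0Pn => i; rewrite A0.
split; last by move=> i iA; apply: le_bigmax_cond.
elim/big_ind: _; first by exists i0.
- move=> x y [i iA ->] [j jA ->]; case: (leP (F i) (F j)) => _;
  by [exists j | exists i].
- by move=> i iA; exists i.
Qed.

Lemma fminP (R : realType) (I : finType) (A : {set I}) (F : I -> R) :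
  A != finset.set0 ->
  (exists2 i, i \in A & fmin A F = F i) /\ {in A, forall i, fmin A F <= F i}.
Proof.
rewrite /fmin; case: pickP => [i0 i0A _|A0]; last first.
  by case/finset.set0Pn => i; rewrite A0.
split; last by move=> i iA; apply: bigmin_le_cond.
elim/big_ind: _; first by exists i0.
- move=> x y [i iA ->] [j jA ->]; case: (leP (F i) (F j)) => _;
  by [exists i | exists j].
- by move=> i iA; exists i.
Qed.

(* The library norm on ['rV[R]_n] is the sup norm (it induces the same
   topology), hence an explicit Euclidean norm. *)
Definition dotp (R : realType) (n : nat) (u v : 'rV[R]_n) : R :=
  (u *m v^T) 0 0.

Definition enorm (R : realType) (n : nat) (u : 'rV[R]_n) : R :=
  Num.sqrt (dotp u u).

Definition specnorm (R : realType) (n : nat) (A : 'M[R]_n) : R :=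
  sup [set enorm (v *m A) | v in [set v : 'rV[R]_n | enorm v <= 1]].

Definition psdmx (R : realType) (n : nat) (A : 'M[R]_n) : Prop :=
  A^T = A /\ forall v : 'rV[R]_n, 0 <= dotp (v *m A) v.

Definition loewner_ge (R : realType) (n : nat) (A B : 'M[R]_n) : Prop :=
  psdmx (A - B).

(* Eigenvalues of a real symmetric matrix in nondecreasing order, repeated
   according to their multiplicity. *)
Definition eigenvalues (R : realType) (n : nat) (A : 'M[R]_n) : seq R :=
  xget [::] [set s : seq R |
    sorted <=%R s /\ char_poly A = \prod_(a <- s) ('X - a%:P)].

Definition lambda2 (R : realType) (n : nat) (A : 'M[R]_n) : R :=
  (eigenvalues A)`_1.

Definition lambda_max (R : realType) (n : nat) (A : 'M[R]_n) : R :=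
  last 0 (eigenvalues A).

Definition gradient (R : realType) (n : nat) (f : 'rV[R]_n -> R)
    (x : 'rV[R]_n) : 'rV[R]_n :=
  \row_j 'D_(delta_mx 0 j) f x.

(* Entry (i, j) is the i-th partial derivative of the j-th partial derivative
   of f. *)
Definition hessian (R : realType) (n : nat) (f : 'rV[R]_n -> R)
    (x : 'rV[R]_n) : 'M[R]_n :=
  'J (gradient f) x.

Definition twice_continuously_differentiable (R : realType) (n : nat)
    (f : 'rV[R]_n -> R) : Prop :=
  [/\ forall x : 'rV[R]_n, differentiable f x,
      forall x : 'rV[R]_n, differentiable (gradient f) x &
      continuous (hessian f)].

Definition locally_strongly_convex (R : realType) (n : nat)
    (f : 'rV[R]_n -> R) : Prop :=
  forall C : set 'rV[R]_n, @convex_set R 'rV[R]_n C -> compact C ->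
    exists2 theta : R, 0 < theta &
      forall x, C x -> loewner_ge (hessian f x) theta%:M.

Definition lipschitz_mx_on (R : realType) (n : nat) (C : set 'rV[R]_n)
    (L : R) (h : 'rV[R]_n -> 'M[R]_n) : Prop :=
  forall x y, C x -> C y -> specnorm (h x - h y) <= L * enorm (x - y).

Definition locally_lipschitz_mx (R : realType) (n : nat)
    (h : 'rV[R]_n -> 'M[R]_n) : Prop :=
  forall C : set 'rV[R]_n, compact C ->
    exists2 L : R, 0 <= L & lipschitz_mx_on C L h.

Definition is_minimizer (R : realType) (n : nat) (f : 'rV[R]_n -> R)
    (x : 'rV[R]_n) : Prop :=
  forall y, f x <= f y.

Definition coercive (R : realType) (n : nat) (f : 'rV[R]_n -> R) : Prop :=
  forall M : R, exists r : R, forall x, r < enorm x -> M < f x.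

Definition conv_hull (R : realType) (n : nat) (A : set 'rV[R]_n) :
    set 'rV[R]_n :=
  smallest (@convex_set R 'rV[R]_n) A.

Definition hessian_bounds (R : realType) (n : nat) (f : 'rV[R]_n -> R)
    (C : set 'rV[R]_n) (tau Tau : R) : Prop :=
  forall x, C x -> loewner_ge Tau%:M (hessian f x) /\
                   loewner_ge (hessian f x) tau%:M.

Definition link (N : nat) (i j : 'I_N) : {set 'I_N} := [set i; j]%SET.

Definition nbrs (N : nat) (E : {set {set 'I_N}}) (i : 'I_N) : {set 'I_N} :=
  [set j | link i j \in E]%SET.

Definition connected_graph (N : nat) (E : {set {set 'I_N}}) : Prop :=
  forall i j : 'I_N, connect [rel u v | link u v \in E] i j.

Definition laplacian (R : realType) (N : nat) (E : {set {set 'I_N}}) :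
    'M[R]_N :=
  \matrix_(i, j) if i == j then #|nbrs E i|%:R
                 else if link i j \in E then -1 else 0.

Definition stack (R : realType) (N n : nat) (z : 'I_N -> 'rV[R]_n) :
    'rV[R]_(N * n) :=
  mxvec (\matrix_(i < N) z i).

(* Vectors being rows, the column formula [H^-1 s] becomes [s *m invmx H]; the
   Hessian H is symmetric. *)
Definition dean_iteration (R : realType) (N n : nat) (E : {set {set 'I_N}})
    (f : 'I_N -> 'rV[R]_n -> R) (alpha : {set 'I_N} -> R)
    (g : {set 'I_N} -> 'rV[R]_n -> R) (xmin : 'I_N -> 'rV[R]_n)
    (x : nat -> 'I_N -> 'rV[R]_n) : Prop :=
  (forall i, x 0%N i = xmin i) /\
  (forall k i, x k.+1 i = x k i +
     (\sum_(j in nbrs E i) alpha (link i j) *: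
        (gradient (g (link i j)) (x k j) - gradient (g (link i j)) (x k i)))
     *m invmx (hessian (f i) (x k i))).

Definition bregman (R : realType) (n : nat) (f : 'rV[R]_n -> R)
    (xstar x : 'rV[R]_n) : R :=
  f xstar - f x - dotp (gradient f x) (xstar - x).

Definition lyapunov (R : realType) (N n : nat) (f : 'I_N -> 'rV[R]_n -> R)
    (xstar : 'rV[R]_n) (x : 'I_N -> 'rV[R]_n) : R :=
  \sum_i bregman (f i) xstar (x i).

Definition sublevel (R : realType) (N n : nat) (f : 'I_N -> 'rV[R]_n -> R)
    (xstar : 'rV[R]_n) (V0 : R) (i : 'I_N) : set 'rV[R]_n :=
  [set x | bregman (f i) xstar x <= V0].

Definition delta (R : realType) (N : nat) (E : {set {set 'I_N}})
    (Gam : {set 'I_N} -> R) (theta : 'I_N -> R) (abar V0 : R) (i : 'I_N) : R :=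
  abar / theta i * \sum_(j in nbrs E i) Gam (link i j) *
    (Num.sqrt (2 * V0 / theta i) + Num.sqrt (2 * V0 / theta j)).

Definition enlarge (R : realType) (n : nat) (C : set 'rV[R]_n) (d : R) :
    set 'rV[R]_n :=
  conv_hull [set x | exists2 y, C y & enorm (x - y) <= d].

Definition step_bound (R : realType) (N : nat) (E : {set {set 'I_N}})
    (theta theta' Theta' L' : 'I_N -> R) (V0 : R) (i : 'I_N) : R :=
  theta i ^+ 2 / #|nbrs E i|%:R *
  (Theta' i - theta' i / 2 + L' i / 2 * Num.sqrt (2 * V0 / theta i))^-1.

Definition rho (R : realType) (N : nat) (E : {set {set 'I_N}})
    (alpha : {set 'I_N} -> R) (theta Theta L : 'I_N -> R) (V0 : R)
    (i : 'I_N) : R :=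
  theta i ^+ 2 /
    (2 * #|nbrs E i|%:R * fmax (nbrs E i) (fun j => alpha (link i j)))
  + theta i / 2 - Theta i - L i / 2 * Num.sqrt (2 * V0 / theta i).

Definition rate (R : realType) (N : nat) (E : {set {set 'I_N}})
    (alpha : {set 'I_N} -> R) (theta Theta : R) : R :=
  Num.max (fmax E alpha * lambda_max (laplacian R E) / theta - 1)
          (1 - fmin E alpha * lambda2 (laplacian R E) / Theta).

(* Main.v *)
Require Import Defs.
From mathcomp Require Import all_boot all_order all_algebra.
From mathcomp Require Import all_classical all_reals all_analysis.
From mathcomp Require Import ring lra complex.

(* In the quadratic case the iteration reads X' = X - H^-1 (W X), with W the
   alpha-weighted Laplacian acting on stacked rows and H the block diagonal of
   Hessians.

   Invariance: the Bregman Lyapunov function changes by the Taylor remainders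
   of the gradients, of order |X' - X|^2, minus <W X, X>, and the latter
   dominates theta_i^2 |x_i' - x_i|^2 / (2 deg_i max alpha).  The step-size
   condition makes the balance nonpositive on the enlarged sets C', so the
   orbit never leaves the sublevel sets; there the same computation with the
   constants of C gives a decrease of sum_i rho_i |x_i' - x_i|^2.

   Rate: I - H^-1 W is self-adjoint for the semi-inner product <W u, v>, with
   numerical range in [1 - c/theta, 1 - d/Theta], where c and d come from
   lambda_max and lambda_2 of the Laplacian; hence <W X, X> contracts by q^2,
   the steps |X' - X| decay like q^k, and their sum converges.

   Error: sum_i grad f_i (x_i) vanishes at the start and changes only by Taylor
   remainders, whose sum is controlled by the total Lyapunov decrease; strong
   monotonicity converts the resulting bound on sum_i grad f_i (xt) into a bound
   on |xt - xstar|. *)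

Set Implicit Arguments.
Unset Strict Implicit.
Unset Printing Implicit Defensive.

Import Order.TTheory GRing.Theory Num.Theory.
Import numFieldNormedType.Exports.

Local Open Scope classical_set_scope.
Local Open Scope ring_scope.

(** * Real symmetric matrices *)

Section SymmetricMatrices.
Variable R : realType.

(** The state is kept as an [N] by [n] matrix with the Frobenius product: the graph acts by left
    multiplication and the Hessians act on the right of each row. Spectral bounds for the [N] by [N]
    Laplacian then apply without Kronecker products.

    The Hessians change at every step, so the spectra of the successive [H^-1 W] do not control
    their product. The semi-inner product attached to [W] is the same for all [k] and contracts by
    the same factor at each step, so the factors multiply. It vanishes on consensus vectors, hence
    the abstract lemmas assume semidefiniteness only.

    Invariance threatens to be circular: Taylor estimates need constants along the segment from
    [x_i] to [x_i'], while those of [C] are available only once [x_i'] is known to lie in [C]. An a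
    priori bound on the displacement, the radius [delta], puts the segment in [C']. Convex hulls
    appear because a sublevel set of a Bregman function in its base point need not be convex.

    Integral remainders are replaced by the scalar mean value theorem along a line, gradients being
    paired with a fixed vector. *)

Lemma Re_mulmx m n p (A : 'M[R[i]]_(m, n)) (B : 'M[R[i]]_(n, p)) :
  map_mx (@complex.Re R) (A *m B) =
  map_mx (@complex.Re R) A *m map_mx (@complex.Re R) B -
  map_mx (@complex.Im R) A *m map_mx (@complex.Im R) B.
Proof.
apply/matrixP => i j; rewrite !mxE.
rewrite (big_morph (@complex.Re R) (id1 := 0) (op1 := +%R)) //; last first.
  by case=> ? ? [].
rewrite -sumrB; apply: eq_bigr => k _; rewrite !mxE.
by case: (A i k) => ? ?; case: (B k j) => ? ?.
Qed.

Lemma Im_mulmx m n p (A : 'M[R[i]]_(m, n)) (B : 'M[R[i]]_(n, p)) :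
  map_mx (@complex.Im R) (A *m B) =
  map_mx (@complex.Re R) A *m map_mx (@complex.Im R) B +
  map_mx (@complex.Im R) A *m map_mx (@complex.Re R) B.
Proof.
apply/matrixP => i j; rewrite !mxE.
rewrite (big_morph (@complex.Im R) (id1 := 0) (op1 := +%R)) //; last first.
  by case=> ? ? [].
rewrite -big_split; apply: eq_bigr => k _; rewrite !mxE.
by case: (A i k) => ? ?; case: (B k j) => ? ?.
Qed.

Lemma char_poly_conj (F : fieldType) n (A D P : 'M[F]_n) :
  P \in unitmx -> P *m A = D *m P -> char_poly A = char_poly D.
Proof.
move=> uP PA; rewrite /char_poly.
have /mulfI : \det (map_mx polyC P) != 0.
  by rewrite det_map_mx polyC_eq0 -unitfE -unitmxE.
apply; rewrite [RHS]mulrC -det_mulmx -det_mulmx; congr (\det _).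
rewrite /char_poly_mx mulmxBl mulmxBr -!map_mxM PA; congr (_ - _).
by rewrite scalar_mxC.
Qed.

(* The rows of P + iM form a unitary eigenbasis of A; keeping complex
   eigenvectors as pairs of real vectors avoids orthogonalizing over R. *)
Lemma symmetric_spectral n (A : 'M[R]_n) : A^T = A ->
  exists (r : 'rV[R]_n) (P M : 'M[R]_n),
    [/\ char_poly A = \prod_i ('X - (r 0 i)%:P),
        P *m A = diag_mx r *m P, M *m A = diag_mx r *m M,
        P^T *m P + M^T *m M = 1%:M & P *m P^T + M *m M^T = 1%:M].
Proof.
move=> symA; pose C := R[i] : numClosedFieldType.
pose B : 'M[C]_n := map_mx (real_complex R) A.
have hermB : B \is hermsymmx.
  apply: realsym_hermsym.
    apply/is_hermitianmxP; rewrite expr0 scale1r map_mx_id //.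
    by apply/matrixP => i j; rewrite !mxE -{1}symA mxE.
  by apply/mxOverP => i j; rewrite mxE; apply/complex_realP; exists (A i j).
have [] := (hermitian_spectral_diag_real hermB,
            orthomx_spectralP (hermitian_normalmx hermB)).
set Q := spectralmx B; set d := spectral_diag B => dreal defB.
have uQ : Q \is unitarymx by apply: spectral_unitarymx.
have QB : Q *m B = diag_mx d *m Q.
  by rewrite defB !mulmxA mulmxV ?spectral_unit// mul1mx.
(* The eigenvalues are real, so the eigenvector equation over [R[i]] splits into one equation for
   the real part of [Q] and one for its imaginary part. *)
pose r : 'rV[R]_n := map_mx (@complex.Re R) d.
have dE : d = map_mx (real_complex R) r.
  apply/matrixP => i j; rewrite !mxE; apply/esym/RRe_real.
  by move/mxOverP: dreal.
have ReB : map_mx (@complex.Re R) B = A by apply/matrixP => i j; rewrite !mxE.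
have ImB : map_mx (@complex.Im R) B = 0 by apply/matrixP => i j; rewrite !mxE.
have ReD : map_mx (@complex.Re R) (diag_mx d) = diag_mx r.
  by apply/matrixP => i j; rewrite !mxE; case: eqP.
have ImD : map_mx (@complex.Im R) (diag_mx d) = 0.
  by apply/matrixP => i j; rewrite dE !mxE; case: eqP.
have Re1 : map_mx (@complex.Re R) (1%:M : 'M[C]_n) = 1%:M.
  by apply/matrixP => i j; rewrite !mxE; case: eqP.
have ReQ : map_mx (@complex.Re R) (Q ^t Num.conj)%sesqui =
    (map_mx (@complex.Re R) Q)^T.
  by apply/matrixP => i j; rewrite !mxE; case: (Q j i).
have ImQ : map_mx (@complex.Im R) (Q ^t Num.conj)%sesqui =
    - (map_mx (@complex.Im R) Q)^T.
  by apply/matrixP => i j; rewrite !mxE; case: (Q j i).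
have QQ := unitarymxP uQ.
have Q'Q : (Q ^t Num.conj)%sesqui *m Q = 1%:M.
  by rewrite -invmx_unitary// mulVmx// spectral_unit.
exists r, (map_mx (@complex.Re R) Q), (map_mx (@complex.Im R) Q); split.
- apply: (map_poly_inj (real_complex R)); rewrite map_char_poly.
  rewrite (char_poly_conj (spectral_unit B) QB) char_poly_trig; last first.
    by apply: is_diag_mx_is_trig; apply: diag_mx_is_diag.
  rewrite rmorph_prod; apply: eq_bigr => i _ /=.
  by rewrite rmorphB/= map_polyX map_polyC/= dE !mxE eqxx.
- move: (congr1 (map_mx (@complex.Re R)) QB).
  by rewrite !Re_mulmx ReB ImB ReD ImD mulmx0 mul0mx !subr0.
- move: (congr1 (map_mx (@complex.Im R)) QB).
  by rewrite !Im_mulmx ReB ImB ReD ImD mulmx0 mul0mx add0r addr0.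
- move: (congr1 (map_mx (@complex.Re R)) Q'Q).
  by rewrite !Re_mulmx ReQ ImQ Re1 mulNmx opprK.
- move: (congr1 (map_mx (@complex.Re R)) QQ).
  by rewrite !Re_mulmx ReQ ImQ Re1 mulmxN opprK.
Qed.
End SymmetricMatrices.

(** * Semi-inner products *)

Section SemiInnerProduct.
Variables (R : realType) (V : lmodType R) (F : V -> V -> R).

Definition semi_inner :=
  [/\ forall a u v w, F (a *: u + v) w = a * F u w + F v w,
      forall u v, F u v = F v u & forall u, 0 <= F u u].

Hypothesis ipF : semi_inner.

Lemma ip_linr a u v w : F w (a *: u + v) = a * F w u + F w v.
Proof. by case: ipF => lin sym _; rewrite sym lin !(sym w). Qed.

Lemma ip_quad a u v : F (a *: u + v) (a *: u + v) =
  a ^+ 2 * F u u + 2 * a * F u v + F v v.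
Proof. by case: ipF => lin sym _; rewrite lin !ip_linr (sym v u); ring. Qed.

(** The form may be degenerate, so a null vector [u] is treated apart from the usual discriminant
    argument. *)
Lemma ip_cauchy_schwarz u v : F u v ^+ 2 <= F u u * F v v.
Proof.
case: ipF => lin sym pos.
have quad a : 0 <= a ^+ 2 * F u u + 2 * a * F u v + F v v.
  by rewrite -ip_quad.
have [u0|u_neq0] := eqVneq (F u u) 0.
  suff -> : F u v = 0 by rewrite u0 mul0r expr0n.
  apply/eqP; apply: contraT => uv_neq0.
  (* With [F u u = 0] the quadratic is affine in [a]; at this point its value is -1. *)
  have := quad (- (F v v + 1) / (2 * F u v)).
  rewrite u0 mulr0 add0r.
  have -> : 2 * (- (F v v + 1) / (2 * F u v)) * F u v = - (F v v + 1).
    by field.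
  by lra.
have u_gt0 : 0 < F u u by rewrite lt_def u_neq0 pos.
(* This is the minimizer of the quadratic. *)
have := quad (- F u v / F u u).
have -> : (- F u v / F u u) ^+ 2 * F u u + 2 * (- F u v / F u u) * F u v + F v v
   = (F u u * F v v - F u v ^+ 2) / F u u by field.
by rewrite pmulr_lge0 ?invr_gt0// subr_ge0.
Qed.

(* Polarization bounds F (T u) w; then take w = T u / q. *)
Lemma ip_selfadjoint_norm (T : V -> V) (q : R) :
  (forall u v, F (T u) v = F u (T v)) ->
  (forall a u v, T (a *: u + v) = a *: T u + T v) ->
  0 <= q -> (forall u, `|F (T u) u| <= q * F u u) ->
  forall u, F (T u) (T u) <= q ^+ 2 * F u u.
Proof.
case: ipF => lin sym pos Tsym Tlin q_ge0 Tq u.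
have polar a w : 2 * a * F (T u) w <= q * (a ^+ 2 * F w w + F u u).
  have h1 : F (T (a *: w + u)) (a *: w + u) -
      F (T (- a *: w + u)) (- a *: w + u) = 4 * a * F (T u) w.
    rewrite !Tlin !lin !ip_linr (Tsym w u) (sym w (T u)); ring.
  have h2 := Tq (a *: w + u); have h3 := Tq (- a *: w + u).
  rewrite !ip_quad in h2 h3.
  move: h2 h3; rewrite !ler_norml => /andP[_ h2] /andP[h3 _].
  have : 4 * a * F (T u) w <= q * (2 * (a ^+ 2 * F w w + F u u)).
    rewrite -h1; apply: le_trans (lerB h2 h3) _.
    by rewrite sqrrN; lra.
  by lra.
have := polar _ (T u); set m := F (T u) (T u) => bound.
have m_ge0 : 0 <= m by apply: pos.
have [q0|q_neq0] := eqVneq q 0.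
  by have := bound 1; rewrite q0; lra.
have := bound q^-1.
have -> : q * (q^-1 ^+ 2 * m + F u u) = q^-1 * m + q * F u u by field.
have q_gt0 : 0 < q by rewrite lt_def q_neq0.
move=> h; have : q^-1 * m <= q * F u u by lra.
by rewrite mulrC ler_pdivrMr// => h'; rewrite expr2; lra.
Qed.

End SemiInnerProduct.

Lemma ip_op (R : realType) (V : lmodType R) (F : V -> V -> R) (A : V -> V) :
  semi_inner F -> (forall u v, F (A u) v = F u (A v)) ->
  (forall a u v, A (a *: u + v) = a *: A u + A v) ->
  (forall u, 0 <= F (A u) u) -> semi_inner (fun u v => F (A u) v).
Proof.
move=> [lin sym pos] Asym Alin Apos; split=> //.
  by move=> a u v w; rewrite Alin lin.
by move=> u v; rewrite Asym sym.
Qed.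

(** The operator inequality [A^2 <= c A] without square roots: Cauchy-Schwarz for the form of [A],
    applied to [u] and [A u], gives [m^2 <= p * (c * m)], and [m] cancels. *)
Lemma ip_psd_norm (R : realType) (V : lmodType R) (F : V -> V -> R)
    (A : V -> V) (c : R) :
  semi_inner F -> (forall u v, F (A u) v = F u (A v)) ->
  (forall a u v, A (a *: u + v) = a *: A u + A v) ->
  0 <= c -> (forall u, 0 <= F (A u) u <= c * F u u) ->
  forall u, F (A u) (A u) <= c * F (A u) u.
Proof.
move=> ipF Asym Alin c_ge0 Ac u.
have A_ge0 w : 0 <= F (A w) w by case/andP: (Ac w).
have := ip_cauchy_schwarz (ip_op ipF Asym Alin A_ge0) u (A u).
set m := F (A u) (A u); set p := F (A u) u.
have m_ge0 : 0 <= m by case: ipF => _ _; apply.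
have p_ge0 : 0 <= p by apply: A_ge0.
case/andP: (Ac (A u)) => _; rewrite -/m => Am cs.
have [->|m_neq0] := eqVneq m 0; first exact: mulr_ge0.
rewrite -(ler_pM2r (_ : 0 < m)); last by rewrite lt_def m_neq0.
by rewrite -expr2; apply: le_trans cs _; rewrite mulrAC [_ * p]mulrC ler_wpM2l.
Qed.

(* With [W] a semidefinite operator and [K] an inverse Hessian, [1 - K W] is
   self-adjoint for the form [F (W u) v], where its numerical range lies in
   [1 - c/tau, 1 - d/Tau]. *)
Lemma ip_newton_contraction (R : realType) (V : lmodType R) (F : V -> V -> R)
    (W K : V -> V) (c d tau Tau : R) :
  semi_inner F ->
  (forall u v, F (W u) v = F u (W v)) -> (forall u v, F (K u) v = F u (K v)) ->
  (forall a u v, W (a *: u + v) = a *: W u + W v) ->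
  (forall a u v, K (a *: u + v) = a *: K u + K v) ->
  0 < tau -> 0 < Tau -> 0 <= c ->
  (forall u, 0 <= F (W u) u <= c * F u u) ->
  (forall u, d * F (W u) u <= F (W u) (W u)) ->
  (forall u, Tau^-1 * F u u <= F (K u) u <= tau^-1 * F u u) ->
  forall q, 0 <= q -> c / tau - 1 <= q -> 1 - d / Tau <= q ->
  forall u, F (W (u - K (W u))) (u - K (W u)) <= q ^+ 2 * F (W u) u.
Proof.
move=> ipF Wsym Ksym Wlin Klin tau_gt0 Tau_gt0 c_ge0 Wc Wd Kb q q_ge0 cq dq u.
have W_ge0 w : 0 <= F (W w) w by case/andP: (Wc w).
have WW := ip_psd_norm ipF Wsym Wlin c_ge0 Wc.
have ipW := ip_op ipF Wsym Wlin W_ge0.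
have FB x y z : F (x - y) z = F x z - F y z.
  by case: (ipF) => lin _ _; rewrite -scaleN1r addrC lin mulN1r addrC.
have FBr x y z : F z (x - y) = F z x - F z y.
  by case: (ipF) => _ sym _; rewrite sym FB !(sym _ z).
have WB x y : W (x - y) = W x - W y.
  by rewrite -scaleN1r addrC Wlin scaleN1r addrC.
apply: (@ip_selfadjoint_norm _ _ _ ipW (fun u => u - K (W u)) q) => //.
- move=> x y; rewrite WB FB FBr; congr (_ - _).
  by rewrite Wsym Ksym.
- by move=> a x y; rewrite Wlin Klin scalerBr opprD addrACA.
- move=> {}u; rewrite WB FB (Wsym (K _)).
  case/andP: (Kb (W u)) => K1 K2.
  (* The two ends of the numerical range: [tau] and [Tau] compare [F (K (W u)) (W u)] with
     [F (W u) (W u)], which [c] and [d] compare with [F (W u) u]. *)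
  have h1 : F (K (W u)) (W u) <= (q + 1) * F (W u) u.
    apply: le_trans K2 _; apply: (@le_trans _ _ (tau^-1 * (c * F (W u) u))).
      by rewrite ler_pM2l ?invr_gt0.
    by rewrite mulrA ler_wpM2r// mulrC; lra.
  have h2 : (1 - q) * F (W u) u <= F (K (W u)) (W u).
    apply: le_trans K1; apply: (@le_trans _ _ (Tau^-1 * (d * F (W u) u))).
      by rewrite mulrA ler_wpM2r// mulrC; lra.
    by rewrite ler_pM2l ?invr_gt0.
  by rewrite ler_norml; apply/andP; split; lra.
Qed.

(** * Frobenius inner product *)

Section Frobenius.
Variable R : realType.

Definition mxdot m n (X Y : 'M[R]_(m, n)) : R := \tr (X *m Y^T).
Definition frob m n (X : 'M[R]_(m, n)) : R := Num.sqrt (mxdot X X).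

Lemma mxdotE m n (X Y : 'M[R]_(m, n)) :
  mxdot X Y = \sum_i \sum_j X i j * Y i j.
Proof.
by apply: eq_bigr => i _; rewrite mxE; apply: eq_bigr => j _; rewrite mxE.
Qed.

Lemma dotpE n (u v : 'rV[R]_n) : dotp u v = mxdot u v.
Proof. by rewrite /mxdot trace_mx11. Qed.

Lemma enormE n (u : 'rV[R]_n) : enorm u = frob u.
Proof. by rewrite /enorm dotpE. Qed.

Lemma mxdot_row m n (X Y : 'M[R]_(m, n)) :
  mxdot X Y = \sum_i mxdot (row i X) (row i Y).
Proof.
rewrite mxdotE; apply: eq_bigr => i _; rewrite mxdotE big_ord1.
by apply: eq_bigr => j _; rewrite !mxE.
Qed.

Lemma mxdotC m n (X Y : 'M[R]_(m, n)) : mxdot X Y = mxdot Y X.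
Proof. by rewrite /mxdot -mxtrace_tr trmx_mul trmxK. Qed.

Lemma mxdotDl m n (X Y Z : 'M[R]_(m, n)) :
  mxdot (X + Y) Z = mxdot X Z + mxdot Y Z.
Proof. by rewrite /mxdot mulmxDl mxtraceD. Qed.

Lemma mxdotZl m n a (X Y : 'M[R]_(m, n)) : mxdot (a *: X) Y = a * mxdot X Y.
Proof. by rewrite /mxdot -scalemxAl mxtraceZ. Qed.

Lemma mxdotDr m n (X Y Z : 'M[R]_(m, n)) :
  mxdot Z (X + Y) = mxdot Z X + mxdot Z Y.
Proof. by rewrite !(mxdotC Z) mxdotDl. Qed.

Lemma mxdotZr m n a (X Y : 'M[R]_(m, n)) : mxdot Y (a *: X) = a * mxdot Y X.
Proof. by rewrite !(mxdotC Y) mxdotZl. Qed.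

Lemma mxdotNl m n (X Y : 'M[R]_(m, n)) : mxdot (- X) Y = - mxdot X Y.
Proof. by rewrite -scaleN1r mxdotZl mulN1r. Qed.

Lemma mxdotNr m n (X Y : 'M[R]_(m, n)) : mxdot Y (- X) = - mxdot Y X.
Proof. by rewrite !(mxdotC Y) mxdotNl. Qed.

Lemma mxdotBl m n (X Y Z : 'M[R]_(m, n)) :
  mxdot (X - Y) Z = mxdot X Z - mxdot Y Z.
Proof. by rewrite mxdotDl mxdotNl. Qed.

Lemma mxdotBr m n (X Y Z : 'M[R]_(m, n)) :
  mxdot Z (X - Y) = mxdot Z X - mxdot Z Y.
Proof. by rewrite mxdotDr mxdotNr. Qed.

Lemma mxdot0l m n (X : 'M[R]_(m, n)) : mxdot 0 X = 0.
Proof. by rewrite /mxdot mul0mx mxtrace0. Qed.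

Lemma mxdot0r m n (X : 'M[R]_(m, n)) : mxdot X 0 = 0.
Proof. by rewrite mxdotC mxdot0l. Qed.

Lemma mxdot_suml m n (I : finType) (A : {pred I}) (X : I -> 'M[R]_(m, n)) Y :
  mxdot (\sum_(i in A) X i) Y = \sum_(i in A) mxdot (X i) Y.
Proof. by rewrite /mxdot mulmx_suml raddf_sum. Qed.

Lemma mxdot_ge0 m n (X : 'M[R]_(m, n)) : 0 <= mxdot X X.
Proof.
by rewrite mxdotE; do 2!apply: sumr_ge0 => ? _; rewrite -expr2 sqr_ge0.
Qed.

Lemma mxdot_adjl m n p (A : 'M[R]_(p, m)) (X : 'M[R]_(m, n)) Y :
  mxdot (A *m X) Y = mxdot X (A^T *m Y).
Proof. by rewrite /mxdot trmx_mul trmxK -mulmxA mxtrace_mulC !mulmxA. Qed.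

Lemma mxdot_adjr m n p (A : 'M[R]_(n, p)) (X : 'M[R]_(m, n)) Y :
  mxdot (X *m A) Y = mxdot X (Y *m A^T).
Proof. by rewrite /mxdot trmx_mul trmxK mulmxA. Qed.

Lemma mxdot_semi_inner m n : semi_inner (@mxdot m n).
Proof.
split=> [a u v w|u v|u]; rewrite ?mxdotDl ?mxdotZl//; first exact: mxdotC.
exact: mxdot_ge0.
Qed.

Lemma frob_ge0 m n (X : 'M[R]_(m, n)) : 0 <= frob X.
Proof. exact: sqrtr_ge0. Qed.

Lemma sqr_frob m n (X : 'M[R]_(m, n)) : frob X ^+ 2 = mxdot X X.
Proof. by rewrite sqr_sqrtr ?mxdot_ge0. Qed.

Lemma frob_le m n (X : 'M[R]_(m, n)) a :
  0 <= a -> (frob X <= a) = (mxdot X X <= a ^+ 2).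
Proof. by move=> a0; rewrite -sqr_frob ler_sqr// nnegrE frob_ge0. Qed.

Lemma mxdot_le m n (X Y : 'M[R]_(m, n)) : mxdot X Y <= frob X * frob Y.
Proof.
apply: le_trans (ler_norm _) _.
rewrite -ler_sqr ?nnegrE ?mulr_ge0 ?frob_ge0// -normrX ger0_norm ?sqr_ge0//.
rewrite exprMn !sqr_frob.
exact: ip_cauchy_schwarz (mxdot_semi_inner m n) _ _.
Qed.

Lemma frobZ m n a (X : 'M[R]_(m, n)) : frob (a *: X) = `|a| * frob X.
Proof.
by rewrite /frob mxdotZl mxdotZr mulrA -expr2 sqrtrM ?sqr_ge0// sqrtr_sqr.
Qed.

Lemma frobN m n (X : 'M[R]_(m, n)) : frob (- X) = frob X.
Proof. by rewrite -scaleN1r frobZ normrN1 mul1r. Qed.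

Lemma frob0 m n : frob (0 : 'M[R]_(m, n)) = 0.
Proof. by rewrite /frob mxdot0l sqrtr0. Qed.

Lemma frobD m n (X Y : 'M[R]_(m, n)) : frob (X + Y) <= frob X + frob Y.
Proof.
rewrite frob_le ?addr_ge0 ?frob_ge0// sqrrD !sqr_frob mxdotDl !mxdotDr.
by have := mxdot_le X Y; rewrite (mxdotC Y X) -mulr_natr; lra.
Qed.

Lemma frobB m n (X Y : 'M[R]_(m, n)) : frob (X - Y) <= frob X + frob Y.
Proof. by rewrite -(frobN Y) frobD. Qed.

Lemma frob_sum m n (I : finType) (A : {pred I}) (X : I -> 'M[R]_(m, n)) :
  frob (\sum_(i in A) X i) <= \sum_(i in A) frob (X i).
Proof.
elim/big_ind2: _ => [|a b c d ab cd|//]; first by rewrite frob0.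
by apply: le_trans (frobD _ _) _; apply: lerD.
Qed.

Lemma entry_le_frob m n (X : 'M[R]_(m, n)) i j : `|X i j| <= frob X.
Proof.
rewrite -ler_sqr ?nnegrE ?frob_ge0// sqr_frob mxdotE -normrX.
rewrite ger0_norm ?sqr_ge0//.
rewrite (bigD1 i)//= (bigD1 j)//= -expr2 -addrA lerDl addr_ge0//.
  by apply: sumr_ge0 => ? _; rewrite -expr2 sqr_ge0.
by apply: sumr_ge0 => ? _; apply: sumr_ge0 => ? _; rewrite -expr2 sqr_ge0.
Qed.

Lemma frob_eq0 m n (X : 'M[R]_(m, n)) : (frob X == 0) = (X == 0).
Proof.
apply/eqP/eqP => [X0|->]; last exact: frob0.
apply/matrixP => i j; rewrite mxE; apply/eqP.
by rewrite -normr_le0 -X0 entry_le_frob.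
Qed.

Lemma frob_row_le m n (X : 'M[R]_(m, n)) i : frob (row i X) <= frob X.
Proof.
rewrite frob_le ?frob_ge0// sqr_frob (mxdot_row X) (bigD1 i)//= lerDl.
by apply: sumr_ge0 => ? _; apply: mxdot_ge0.
Qed.

Lemma frob_mulmx m n p (X : 'M[R]_(m, n)) (Y : 'M[R]_(n, p)) :
  frob (X *m Y) <= frob X * frob Y.
Proof.
rewrite frob_le ?mulr_ge0 ?frob_ge0// exprMn !sqr_frob.
have dotE i j : (X *m Y) i j = mxdot (row i X) (col j Y)^T.
  by rewrite mxdotE big_ord1 mxE; apply: eq_bigr => k _; rewrite !mxE.
have -> : mxdot Y Y = \sum_j mxdot (col j Y)^T (col j Y)^T.
  rewrite mxdotE exchange_big/=; apply: eq_bigr => j _.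
  by rewrite mxdotE big_ord1; apply: eq_bigr => k _; rewrite !mxE.
rewrite mxdotE (mxdot_row X) mulr_suml ler_sum// => i _.
rewrite mulr_sumr ler_sum// => j _; rewrite dotE -expr2.
exact: ip_cauchy_schwarz (mxdot_semi_inner 1 n) _ _.
Qed.

Lemma frob_specnorm n (A : 'M[R]_n) (v : 'rV[R]_n) :
  frob (v *m A) <= specnorm A * frob v.
Proof.
have [->|v_neq0] := eqVneq v 0; first by rewrite mul0mx !frob0 mulr0.
have v_gt0 : 0 < frob v by rewrite lt_def frob_eq0 v_neq0 frob_ge0.
rewrite -ler_pdivrMr//; apply: ub_le_sup.
  (* A value lies below [sup] only once the set is known to be bounded; [frob A] bounds it. *)
  exists (frob A) => y [w]; rewrite /= !enormE => w1 <-.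
  by apply: le_trans (frob_mulmx _ _) _; rewrite ler_piMl// frob_ge0.
exists ((frob v)^-1 *: v) => /=; last first.
  by rewrite enormE -scalemxAl frobZ ger0_norm ?invr_ge0 ?frob_ge0// mulrC.
by rewrite enormE frobZ ger0_norm ?invr_ge0 ?frob_ge0// mulVf ?gt_eqF.
Qed.

Lemma frob_stack N n (z : 'I_N -> 'rV[R]_n) :
  frob (stack z) = frob (\matrix_(i < N) z i).
Proof.
congr Num.sqrt; rewrite !mxdotE big_ord1 pair_big/=.
rewrite (reindex _ (curry_mxvec_bij _ _))/=.
by apply: eq_bigr => -[i j] _ /=; rewrite mxvecE.
Qed.
End Frobenius.

(** * Rayleigh quotients *)

Section Rayleigh.
Variable R : realType.

(** [eigenvalues] is a choice, so one admissible sequence must be exhibited: the sorted roots.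
    Unique factorization then identifies the chosen one up to permutation. *)
Lemma eigenvalues_sorted n (A : 'M[R]_n) (r : 'rV[R]_n) :
  char_poly A = \prod_i ('X - (r 0 i)%:P) ->
  sorted <=%R (eigenvalues A) /\ perm_eq (eigenvalues A) (codom (r 0)).
Proof.
move=> Ar.
have Ar' : char_poly A = \prod_(a <- codom (r 0)) ('X - a%:P).
  by rewrite Ar big_image.
have [|sorted_s] := @xgetPex _ [::] [set s : seq R |
    sorted <=%R s /\ char_poly A = \prod_(a <- s) ('X - a%:P)].
  exists (sort <=%R (codom (r 0))); split; first exact/sort_sorted/le_total.
  by rewrite Ar'; apply/esym/perm_big; rewrite perm_sort.
rewrite -/(eigenvalues A) Ar' => /esym/prod_XsubC_eq perm_s; split=> //.
Qed.

Lemma sorted_le_nth (s : seq R) x i : sorted <=%R s -> x \in s ->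
  (i <= index x s)%N -> s`_i <= x.
Proof.
move=> sorted_s xs ix; rewrite -[leRHS](nth_index 0 xs).
have xlt : (index x s < size s)%N by rewrite index_mem.
by apply: (le_sorted_leq_nth 0 sorted_s) => //; rewrite inE (leq_ltn_trans ix).
Qed.

Lemma sorted_le_last (s : seq R) x : sorted <=%R s -> x \in s -> x <= last 0 s.
Proof.
move=> sorted_s xs; rewrite -{1}(nth_index 0 xs) -nth_last.
have xlt : (index x s < size s)%N by rewrite index_mem.
apply: (le_sorted_leq_nth 0 sorted_s) => //; rewrite ?inE ?prednK//.
  exact: leq_ltn_trans xlt.
by rewrite -ltnS prednK// (leq_ltn_trans _ xlt).
Qed.

Lemma mxdot_diag m n (r : 'rV[R]_m) (X : 'M[R]_(m, n)) :
  mxdot (diag_mx r *m X) X = \sum_i r 0 i * mxdot (row i X) (row i X).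
Proof.
rewrite mxdot_row; apply: eq_bigr => i _.
by rewrite row_mul row_diag_mx -scalemxAl -rowE mxdotZl.
Qed.

(** Parseval's identity for the unitary matrix P + iM, written with its real and imaginary parts. *)
Lemma mxdot_parseval n p (P M : 'M[R]_n) (X Y : 'M[R]_(n, p)) :
  P^T *m P + M^T *m M = 1%:M ->
  mxdot X Y = mxdot (P *m X) (P *m Y) + mxdot (M *m X) (M *m Y).
Proof.
move=> PM; rewrite -[X in LHS]mul1mx -PM mulmxDl mxdotDl.
by rewrite -!mulmxA !mxdot_adjl !trmxK.
Qed.

Lemma rayleigh_spectral n p (A P M : 'M[R]_n) (r : 'rV[R]_n)
    (X : 'M[R]_(n, p)) :
  P *m A = diag_mx r *m P -> M *m A = diag_mx r *m M ->
  P^T *m P + M^T *m M = 1%:M ->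
  mxdot (A *m X) X =
  \sum_i r 0 i * (mxdot (row i (P *m X)) (row i (P *m X)) +
                  mxdot (row i (M *m X)) (row i (M *m X))).
Proof.
move=> PA MA PM; rewrite (mxdot_parseval _ _ PM) !mulmxA PA MA -!mulmxA.
by rewrite !mxdot_diag -big_split; apply: eq_bigr => i _; rewrite mulrDr.
Qed.

Lemma rayleigh_le_lambda_max n p (A : 'M[R]_n) (X : 'M[R]_(n, p)) : A^T = A ->
  mxdot (A *m X) X <= lambda_max A * mxdot X X.
Proof.
move=> /symmetric_spectral[r [P [M [charA PA MA PM _]]]].
rewrite (rayleigh_spectral _ PA MA PM) (mxdot_parseval _ _ PM) !mxdot_row.
rewrite -big_split mulr_sumr ler_sum// => i _ /=.
rewrite ler_wpM2r ?addr_ge0 ?mxdot_ge0//.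
have [sorted_s perm_s] := eigenvalues_sorted charA.
by apply: sorted_le_last => //; rewrite (perm_mem perm_s) codom_f.
Qed.

(** The point is that 0 is a simple eigenvalue. The squared coordinates of the all-one vector [e] in
    the eigenbasis sum to [N]. An eigenvector for 0 has constant real and imaginary parts and so
    carries all of this mass, the others carry none; hence exactly one index [i0] belongs to 0. If
    the columns of [X] sum to 0, then [X] has no component along [i0], and every other eigenvalue is
    at least the second entry of the sorted list. *)
Lemma lambda2_rayleigh N (A : 'M[R]_N) : (2 <= N)%N -> A^T = A ->
  (forall v : 'cV_N, 0 <= mxdot (A *m v) v) ->
  A *m const_mx 1 = 0 :> 'cV_N ->
  (forall v : 'cV_N, A *m v = 0 -> forall i j, v i 0 = v j 0) ->
  0 < lambda2 A /\
  forall p (X : 'M[R]_(N, p)), const_mx 1 *m X = 0 :> 'rV_p ->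
    lambda2 A * mxdot X X <= mxdot (A *m X) X.
Proof.
move=> N_ge2 symA psdA A1 kerA.
have [r [P [M [charA PA MA PM PM']]]] := symmetric_spectral symA.
have [sorted_s perm_s] := eigenvalues_sorted charA.
have eigen Q i : Q *m A = diag_mx r *m Q ->
    A *m (row i Q)^T = r 0 i *: (row i Q)^T.
  move=> QA; rewrite -{1}symA -trmx_mul -row_mul QA row_mul row_diag_mx.
  by rewrite -scalemxAl -rowE linearZ.
have norm1 i :
    mxdot (row i P)^T (row i P)^T + mxdot (row i M)^T (row i M)^T = 1.
  move/matrixP: PM' => /(_ i i); rewrite !mxE eqxx mulr1n => <-.
  rewrite !mxdotE.
  by congr (_ + _); apply: eq_bigr => k _; rewrite big_ord1 !mxE.
have r_ge0 i : 0 <= r 0 i.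
  have := addr_ge0 (psdA (row i P)^T) (psdA (row i M)^T).
  by rewrite !eigen// !mxdotZl -mulrDr norm1 mulr1.
pose e := const_mx 1 : 'cV[R]_N.
have ee : mxdot e e = N%:R.
  rewrite mxdotE; under eq_bigr => i _ do rewrite big_ord1 !mxE mulr1.
  by rewrite sumr_const card_ord.
have N_gt0 : 0 < N%:R :> R by rewrite ltr0n; apply: leq_trans N_ge2.
have ker_const Q i : Q *m A = diag_mx r *m Q -> r 0 i = 0 ->
    exists a, row i Q = const_mx a.
  move=> QA ri0; have := eigen Q i QA; rewrite ri0 scale0r => /kerA h.
  exists ((row i Q)^T (Ordinal (leq_trans (ltnSn 0) (ltnW N_ge2))) 0).
  by apply/rowP => j; rewrite [RHS]mxE -(h j) [RHS]mxE.
(* If row [i] is constant, equal to [a] in [P] and [b] in [M], normalization reads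
   [N (a^2 + b^2) = 1], and the mass of [e] there is [N^2 (a^2 + b^2)]. *)
have const_mass i : r 0 i = 0 -> (P *m e) i 0 ^+ 2 + (M *m e) i 0 ^+ 2 = N%:R.
  move=> ri0; have [a Pa] := ker_const P i PA ri0.
  have [b Mb] := ker_const M i MA ri0; have := norm1 i; rewrite Pa Mb.
  have nrm (c : R) : mxdot (const_mx c : 'rV_N)^T (const_mx c : 'rV_N)^T
      = N%:R * c ^+ 2.
    rewrite mxdotE; under eq_bigr => k _ do rewrite big_ord1 !mxE -expr2.
    by rewrite sumr_const card_ord mulr_natl.
  have val Q (c : R) : row i Q = const_mx c -> (Q *m e) i 0 = N%:R * c.
    move=> Qc; rewrite mxE; under eq_bigr => k _.
      have -> : Q i k = c by have /rowP/(_ k) := Qc; rewrite !mxE.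
      rewrite mxE mulr1; over.
    by rewrite sumr_const card_ord mulr_natl.
  rewrite !nrm (val P a)// (val M b)// => h.
  rewrite !exprMn expr2 -!mulrA -!mulrDr -[RHS]mulr1; congr (_ * _).
  by rewrite mulrDr.
have mass : \sum_i ((P *m e) i 0 ^+ 2 + (M *m e) i 0 ^+ 2) = N%:R.
  rewrite -ee (mxdot_parseval _ _ PM) !mxdotE -big_split; apply: eq_bigr => i _.
  by rewrite !big_ord1 -!expr2.
have mass_ge0 i : 0 <= (P *m e) i 0 ^+ 2 + (M *m e) i 0 ^+ 2.
  by rewrite addr_ge0 ?sqr_ge0.
have mass0 i : r 0 i != 0 -> (P *m e) i 0 ^+ 2 + (M *m e) i 0 ^+ 2 = 0.
  move=> ri0.
  have val Q : Q *m A = diag_mx r *m Q -> (Q *m e) i 0 = 0.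
    move=> QA; have := congr1 (mulmx^~ e) QA; rewrite /= -!mulmxA A1 mulmx0.
    move=> /matrixP/(_ i 0); rewrite mxE mul_diag_mx mxE => /esym/eqP.
    by rewrite mulf_eq0 (negPf ri0) => /eqP.
  by rewrite !val// expr0n addr0.
have [i0 ri0] : exists i, r 0 i = 0.
  apply/not_existsP => r_neq0; move: mass; rewrite big1 => [/eqP|i _].
    by rewrite eq_sym gt_eqF.
  by apply: mass0; apply/eqP/r_neq0.
have uniq0 i : r 0 i = 0 -> i = i0.
  move=> ri; apply/eqP; apply: contraT => ii0; move: mass.
  rewrite (bigD1 i)//= (bigD1 i0) 1?eq_sym//= !const_mass//.
  set S := \sum_(_ < _ | _) _; have : 0 <= S by apply: sumr_ge0.
  by lra.
set s := eigenvalues A in sorted_s perm_s *.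
have mem_s i : r 0 i \in s by rewrite (perm_mem perm_s) codom_f.
have size_s : size s = N by rewrite (perm_size perm_s) size_codom card_ord.
have s_ge0 i : (i < N)%N -> 0 <= s`_i.
  rewrite -size_s => /(mem_nth 0); rewrite (perm_mem perm_s) => /codomP[j ->].
  exact: r_ge0.
have s_le i : i != i0 -> s`_1 <= r 0 i.
  move=> ii0; apply: sorted_le_nth => //; rewrite lt0n.
  apply: contra ii0 => /eqP ind0; apply/eqP/uniq0/le_anti.
  rewrite r_ge0 andbT -(nth_index 0 (mem_s i)) ind0 -[leRHS]ri0.
  by apply: sorted_le_nth.
(* If the entry of index 1 were 0, so would be the one of index 0, and 0 would be counted twice. *)
have count0 : count_mem 0 s = 1%N.
  rewrite (permP perm_s) count_map -sum1_count big_enum_cond/= (big_pred1 i0)//.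
  by move=> i /=; apply/eqP/eqP => [/uniq0|->].
have lambda2_gt0 : 0 < s`_1.
  rewrite lt_def s_ge0// andbT; apply/eqP => s1.
  have s0 : s`_0 = 0.
    apply: le_anti; rewrite s_ge0 ?(leq_trans _ N_ge2)// andbT.
    by rewrite -[leRHS]ri0; apply: sorted_le_nth.
  move: count0 s0 s1 size_s N_ge2; case: (s) => [|a [|b t]] /=;
    do ?by move=> _ _ _ <-.
  by move=> h a0 b0; rewrite a0 b0 eqxx in h.
split=> // p X X0.
rewrite (rayleigh_spectral _ PA MA PM) (mxdot_parseval _ _ PM).
rewrite ![mxdot (_ *m X) _]mxdot_row -big_split mulr_sumr ler_sum// => i _ /=.
have [->|ii0] := eqVneq i i0; last first.
  by rewrite ler_wpM2r ?addr_ge0 ?mxdot_ge0 ?s_le.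
have row0 Q : Q *m A = diag_mx r *m Q -> row i0 (Q *m X) = 0.
  move=> QA; have [a Qa] := ker_const Q i0 QA ri0.
  have -> : row i0 (Q *m X) = a *: (const_mx 1 *m X).
    rewrite row_mul Qa scalemxAl; congr (_ *m _).
    by apply/rowP => j; rewrite !mxE mulr1.
  by rewrite X0 scaler0.
by rewrite !row0// !mxdot0l addr0 !mulr0.
Qed.
End Rayleigh.

(** * Weighted Laplacians *)

Section Laplacian.
Variable R : realType.

Lemma lambda_max_eigen n (A : 'M[R]_n) : (0 < n)%N -> A^T = A ->
  exists2 v : 'cV[R]_n, v != 0 & A *m v = lambda_max A *: v.
Proof.
move=> n_gt0 symA; have [r [P [M [charA _ _ _ _]]]] := symmetric_spectral symA.
have [sorted_s perm_s] := eigenvalues_sorted charA.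
have mem_last : lambda_max A \in eigenvalues A.
  have := perm_size perm_s; rewrite size_codom card_ord /lambda_max.
  case: (eigenvalues A) => [n0|a s _]; last by rewrite /= mem_last.
  by rewrite -n0 in n_gt0.
have : eigenvalue A (lambda_max A).
  have -> : eigenvalue A (lambda_max A) = root (char_poly A) (lambda_max A).
    exact: eigenvalue_root_char.
  have -> : char_poly A = \prod_(a <- codom (r 0)) ('X - a%:P).
    by rewrite charA big_image.
  by rewrite root_prod_XsubC -(perm_mem perm_s).
case/eigenvalueP => v vA v_neq0; exists v^T; first by rewrite trmx_eq0.
by rewrite -{1}symA -trmx_mul vA linearZ.
Qed.

Lemma lambda_max_le n (A : 'M[R]_n) c : (0 < n)%N -> A^T = A ->
  (forall v : 'cV[R]_n, mxdot (A *m v) v <= c * mxdot v v) -> lambda_max A <= c.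
Proof.
move=> n_gt0 symA Ac; have [v v_neq0 Av] := lambda_max_eigen n_gt0 symA.
have := Ac v; rewrite Av mxdotZl ler_pM2r//.
by rewrite lt_def mxdot_ge0 -sqr_frob expf_neq0// frob_eq0.
Qed.

Lemma lambda2_le_lambda_max N (A : 'M[R]_N) : (2 <= N)%N -> A^T = A ->
  lambda2 A <= lambda_max A.
Proof.
move=> N_ge2 symA; have [r [P [M [charA _ _ _ _]]]] := symmetric_spectral symA.
have [sorted_s perm_s] := eigenvalues_sorted charA.
apply: sorted_le_last => //; apply: mem_nth.
by rewrite (perm_size perm_s) size_codom card_ord.
Qed.

Variables (N : nat) (E : {set {set 'I_N}}).
Hypothesis no_loop : forall i, link i i \notin E.

Definition wlap (alpha : {set 'I_N} -> R) : 'M[R]_N :=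
  \matrix_(i, j) if i == j then \sum_(k in nbrs E i) alpha (link i k)
                 else if link i j \in E then - alpha (link i j) else 0.

Lemma linkC (i j : 'I_N) : link i j = link j i.
Proof. by rewrite /link finset.setUC. Qed.

Lemma nbrsC i j : (j \in nbrs E i) = (i \in nbrs E j).
Proof. by rewrite !inE linkC. Qed.

Lemma laplacian_wlap : laplacian R E = wlap (fun=> 1).
Proof. by apply/matrixP => i j; rewrite !mxE sumr_const. Qed.

Lemma wlap_sym alpha : (wlap alpha)^T = wlap alpha.
Proof.
apply/matrixP => i j; rewrite !mxE eq_sym [link j i]linkC.
by case: eqP => // ->.
Qed.

Lemma row_wlap alpha n (X : 'M[R]_(N, n)) i : row i (wlap alpha *m X) =
  \sum_(j in nbrs E i) alpha (link i j) *: (row i X - row j X).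
Proof.
have -> : row i (wlap alpha *m X) = \sum_j wlap alpha i j *: row j X.
  by rewrite row_mul mulmx_sum_row; apply: eq_bigr => j _; rewrite mxE.
rewrite (bigD1 i)//= mxE eqxx scaler_suml.
under [RHS]eq_bigr => j _ do rewrite scalerBr.
rewrite [RHS]big_split/=; congr (_ + _).
rewrite [RHS](big_setID [set i]%SET)/=.
rewrite (_ : nbrs E i :&: [set i] = finset.set0)%SET; last first.
  apply/setP => j; rewrite !inE andbC; case: eqP => // ->.
  by rewrite (negPf (no_loop i)).
rewrite big_set0 add0r.
rewrite [LHS](bigID [pred j | link i j \in E])/= [X in _ + X]big1 ?addr0.
  apply: eq_big => j; rewrite ?inE /= ?andbT // => /andP[ji ij].
  by rewrite mxE eq_sym (negPf ji) ij scaleNr.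
by move=> j /andP[ji ij]; rewrite mxE eq_sym (negPf ji) (negPf ij) scale0r.
Qed.

(** The Dirichlet form of the weighted graph. Exchanging the two ends of each link and averaging
    symmetrizes the sum; the factor 1/2 is there because each link is met in both directions. *)
Lemma wlap_form alpha n (X Y : 'M[R]_(N, n)) : mxdot (wlap alpha *m X) Y =
  2^-1 * \sum_i \sum_(j in nbrs E i)
    alpha (link i j) * mxdot (row i X - row j X) (row i Y - row j Y).
Proof.
have h : mxdot (wlap alpha *m X) Y =
    \sum_i \sum_(j in nbrs E i)
      alpha (link i j) * mxdot (row i X - row j X) (row i Y).
  rewrite mxdot_row; apply: eq_bigr => i _; rewrite row_wlap mxdot_suml.
  by apply: eq_bigr => j _; rewrite mxdotZl.
have h' : mxdot (wlap alpha *m X) Y =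
    \sum_i \sum_(j in nbrs E i)
      alpha (link i j) * mxdot (row j X - row i X) (row j Y).
  rewrite h (exchange_big_dep predT)//=; apply: eq_bigr => i _.
  by apply: eq_big => j; [exact: nbrsC | rewrite linkC].
apply: (@mulfI _ 2) => //; rewrite mulrA mulfV// mul1r.
rewrite mulr_natl mulr2n {1}h h' -big_split; apply: eq_bigr => i _.
rewrite -big_split; apply: eq_bigr => j _ /=.
by rewrite -mulrDr; congr (_ * _); rewrite !mxdotBl !mxdotBr; ring.
Qed.

Lemma wlap_form_ge0 alpha n (X : 'M[R]_(N, n)) :
  (forall e, e \in E -> 0 <= alpha e) -> 0 <= mxdot (wlap alpha *m X) X.
Proof.
move=> a_ge0; rewrite wlap_form mulr_ge0//.
apply: sumr_ge0 => i _; apply: sumr_ge0 => j; rewrite inE => ij.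
by rewrite mulr_ge0 ?mxdot_ge0 ?a_ge0.
Qed.

Lemma wlap_form_le alpha beta n (X : 'M[R]_(N, n)) :
  (forall e, e \in E -> alpha e <= beta e) ->
  mxdot (wlap alpha *m X) X <= mxdot (wlap beta *m X) X.
Proof.
move=> ab; rewrite !wlap_form ler_pM2l//.
apply: ler_sum => i _; apply: ler_sum => j; rewrite inE => ij.
by rewrite ler_wpM2r ?mxdot_ge0 ?ab.
Qed.

Lemma wlap_cst a n (X : 'M[R]_(N, n)) :
  mxdot (wlap (fun=> a) *m X) X = a * mxdot (laplacian R E *m X) X.
Proof.
rewrite laplacian_wlap !wlap_form mulrCA; congr (_ * _).
rewrite mulr_sumr; apply: eq_bigr => i _.
by rewrite mulr_sumr; apply: eq_bigr => j _; rewrite mul1r.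
Qed.

Lemma wlap_const alpha n (v : 'rV[R]_n) :
  wlap alpha *m (\matrix_(i < N) v) = 0.
Proof.
apply/row_matrixP => i; rewrite row_wlap row0 big1// => j _.
by rewrite !rowK subrr scaler0.
Qed.

(** From [|u - v|^2 <= 2 |u|^2 + 2 |v|^2] in the Dirichlet form, where each node is counted once per
    incident link. *)
Lemma laplacian_lambda_max_le d : (0 < N)%N ->
  (forall i, #|nbrs E i|%:R <= d :> R) -> lambda_max (laplacian R E) <= 2 * d.
Proof.
move=> N_gt0 deg_le; apply: lambda_max_le => //.
  by rewrite laplacian_wlap wlap_sym.
move=> v; rewrite laplacian_wlap wlap_form.
pose s i := mxdot (row i v) (row i v).
have h i : \sum_(j in nbrs E i) (s i + s j) =
    #|nbrs E i|%:R * s i + \sum_(j in nbrs E i) s j.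
  by rewrite big_split/= sumr_const mulr_natl.
apply: (@le_trans _ _ (2^-1 * \sum_i \sum_(j in nbrs E i) 2 * (s i + s j))).
  rewrite ler_pM2l//; apply: ler_sum => i _; apply: ler_sum => j _.
  rewrite mul1r; have := mxdot_ge0 (row i v + row j v).
  by rewrite !(mxdotDl, mxdotDr, mxdotNl, mxdotNr) /s; lra.
under eq_bigr => i _ do rewrite -mulr_sumr h.
rewrite -mulr_sumr mulrA mulVf// mul1r big_split/=.
rewrite [X in _ + X](exchange_big_dep predT)//=.
rewrite [X in _ + X](eq_bigr (fun i => #|nbrs E i|%:R * s i)); last first.
  move=> i _; rewrite (eq_bigl (mem (nbrs E i))) => [|j]; last exact: nbrsC.
  by rewrite sumr_const mulr_natl.
rewrite -mulr2n -[X in X <= _]mulr_natl -[X in _ <= X]mulrA ler_pM2l//.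
rewrite mxdot_row.
rewrite mulr_sumr ler_sum// => i _.
by rewrite ler_wpM2r ?mxdot_ge0.
Qed.

Hypothesis E_connected : connected_graph E.

(** A vanishing sum of nonnegative terms makes rows agree along each link, and connectivity carries
    this along paths. *)
Lemma wlap_form0 alpha n (X : 'M[R]_(N, n)) :
  (forall e, e \in E -> 0 < alpha e) -> mxdot (wlap alpha *m X) X = 0 ->
  forall i j, row i X = row j X.
Proof.
move=> a_gt0; rewrite wlap_form => /eqP; rewrite mulf_eq0 invr_eq0 pnatr_eq0/=.
have term_ge0 i j : j \in nbrs E i ->
    0 <= alpha (link i j) * mxdot (row i X - row j X) (row i X - row j X).
  by rewrite inE => ij; rewrite mulr_ge0 ?mxdot_ge0 ?ltW ?a_gt0.
rewrite psumr_eq0 => [|i _]; last by apply: sumr_ge0 => j; apply: term_ge0.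
move=> /allP sum0 i j.
have step u v : link u v \in E -> row u X = row v X.
  move=> uv; have := sum0 u (mem_index_enum u).
  rewrite /= psumr_eq0; last first.
    by move=> w; apply: term_ge0.
  move=> /allP/(_ v (mem_index_enum v)); rewrite inE uv/=.
  rewrite mulf_eq0 gt_eqF ?a_gt0//= -sqr_frob expf_eq0/= frob_eq0 subr_eq0.
  by move/eqP.
have /connectP[p] := E_connected i j.
elim: p i => [|k p IHp] i /=; first by move=> _ ->.
by case/andP => ik kp jp; rewrite (step _ _ ik); apply: IHp.
Qed.

Lemma laplacian_lambda2 : (2 <= N)%N -> 0 < lambda2 (laplacian R E) /\
  forall p (X : 'M[R]_(N, p)), const_mx 1 *m X = 0 :> 'rV_p ->
    lambda2 (laplacian R E) * mxdot X X <= mxdot (laplacian R E *m X) X.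
Proof.
move=> N_ge2; rewrite laplacian_wlap; apply: lambda2_rayleigh => //.
- exact: wlap_sym.
- by move=> v; apply: wlap_form_ge0.
- rewrite -[RHS](wlap_const (fun=> 1) (const_mx 1)); congr (_ *m _).
  by apply/matrixP => i j; rewrite !mxE.
- move=> v v0 i j; have := @wlap_form0 (fun=> 1) _ v.
  rewrite v0 mxdot0l => /(_ (fun _ _ => ltr01) erefl i j)/rowP/(_ 0).
  by rewrite !mxE.
Qed.
End Laplacian.

(** * Taylor estimates *)

Section Taylor.
Variable R : realType.

Lemma mxdot_continuousl m n (Y : 'M[R]_(m, n)) :
  continuous (fun X : 'M[R]_(m, n) => mxdot X Y).
Proof.
under eq_fun do rewrite mxdotE.
apply: continuous_big => [|i _]; first exact: add_continuous.
apply: continuous_big => [|j _]; first exact: add_continuous.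
move=> X; apply: continuousM; [exact: coord_continuous | exact: cst_continuous].
Qed.

(** Pairing with a fixed [w] turns a vector-valued map along a line into a real function, to which
    the mean value theorem applies. *)
Lemma is_derive_line_mxdot n m (G : 'rV[R]_n -> 'rV[R]_m) (x d : 'rV[R]_n) w t :
  differentiable G (x + t *: d) ->
  is_derive t 1 (fun s : R => mxdot (G (x + s *: d)) w)
    (mxdot ('d G (x + t *: d) d) w).
Proof.
move=> dG; have dGd := @diff_derivable _ _ _ _ _ d dG.
set q := fun h : R => h^-1 *: ((G \o shift (x + t *: d)) (h *: d) -
  G (x + t *: d)).
have qE : (fun h : R => h^-1 *:
    (((fun s : R => mxdot (G (x + s *: d)) w) \o shift t) (h *: 1) -
     mxdot (G (x + t *: d)) w)) = (fun h => mxdot (q h) w).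
  apply/funext => h; rewrite /q /= mxdotZl mxdotBl.
  congr (_ * (mxdot (G _) _ - _)).
  by rewrite -[h *: 1]/(h * 1) mulr1 scalerDl addrCA addrC.
have cv : mxdot (q h) w @[h --> 0^'] --> mxdot ('D_d G (x + t *: d)) w.
  exact: (cvg_comp _ _ dGd (@mxdot_continuousl _ _ w _)).
apply: DeriveDef.
  by rewrite /derivable qE; apply/cvg_ex; eexists; exact: cv.
by rewrite /derive qE -deriveE//; apply/cvg_lim.
Qed.

Lemma gradient_diff n (f : 'rV[R]_n -> R) (p d : 'rV[R]_n) :
  differentiable f p -> 'd f p d = mxdot (gradient f p) d.
Proof.
move=> df; rewrite {1}(row_sum_delta d) linear_sum mxdotE big_ord1.
by apply: eq_bigr => j _; rewrite linearZ mxE deriveE// mulrC.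
Qed.

Lemma is_derive_line n (f : 'rV[R]_n -> R) (x d : 'rV[R]_n) t :
  differentiable f (x + t *: d) ->
  is_derive t 1 (fun s : R => f (x + s *: d))
    (mxdot (gradient f (x + t *: d)) d).
Proof.
move=> df; have dfd := @diff_derivable _ _ _ _ _ d df.
have qE : (fun h : R => h^-1 *:
    (((fun s : R => f (x + s *: d)) \o shift t) (h *: 1) - f (x + t *: d))) =
  (fun h : R => h^-1 *: ((f \o shift (x + t *: d)) (h *: d) - f (x + t *: d))).
  apply/funext => h /=; congr (_ * (f _ - _)).
  by rewrite -[h *: 1]/(h * 1) mulr1 scalerDl addrCA addrC.
apply: DeriveDef; first by rewrite /derivable qE.
by rewrite -gradient_diff// -deriveE// /derive qE.
Qed.

Lemma is_derive_gradient_line n (f : 'rV[R]_n -> R) (x d w : 'rV[R]_n) t :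
  differentiable (gradient f) (x + t *: d) ->
  is_derive t 1 (fun s : R => mxdot (gradient f (x + s *: d)) w)
    (mxdot (d *m hessian f (x + t *: d)) w).
Proof.
move=> dg; have := is_derive_line_mxdot w dg.
by rewrite -deriveE// deriveEjacobian.
Qed.

(** Stands in for integrating the bound [k * t + m] over the unit interval: subtract its
    antiderivative and apply the mean value theorem. *)
Lemma le_of_derive_le (phi phi' : R -> R) (k m : R) :
  (forall t : R, 0 <= t <= 1 -> is_derive t 1 phi (phi' t)) ->
  (forall t : R, 0 <= t <= 1 -> phi' t <= k * t + m) ->
  phi 1 - phi 0 <= k / 2 + m.
Proof.
move=> dphi phi'_le.
pose psi t := phi t - (k / 2 * t ^+ 2 + m * t).
have dpsi (t : R) : 0 <= t <= 1 -> is_derive t 1 psi (phi' t - (k * t + m)).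
  move=> t01; have := dphi t t01 => ?; apply: is_derive_eq.
  by rewrite /GRing.scale/=; field.
have [||c] := @MVT R psi (fun t => phi' t - (k * t + m)) 0 1 ltr01.
- by move=> t; rewrite in_itv/= => /andP[t0 t1]; apply: dpsi; rewrite !ltW.
- apply: derivable_within_continuous => t; rewrite in_itv/= => t01.
  by case: (dpsi t t01).
rewrite in_itv/= => /andP[c0 c1]; rewrite /psi => h.
by have := phi'_le c; rewrite (ltW c0) (ltW c1) => /(_ erefl); lra.
Qed.

Variables (n : nat) (f : 'rV[R]_n -> R).
Hypotheses (df : forall x, differentiable f x)
  (dg : forall x, differentiable (gradient f) x).

Section Segment.
Variables (x d : 'rV[R]_n).

Lemma gradient_diff_le Tau :
  (forall t : R, 0 <= t <= 1 -> loewner_ge Tau%:M (hessian f (x + t *: d))) ->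
  mxdot (gradient f (x + d) - gradient f x) d <= Tau * mxdot d d.
Proof.
move=> Hle.
have := @le_of_derive_le (fun t => mxdot (gradient f (x + t *: d)) d)
  (fun t => mxdot (d *m hessian f (x + t *: d)) d) 0 (Tau * mxdot d d).
rewrite scale1r scale0r addr0 mul0r add0r mxdotBl; apply.
  by move=> t _; apply: is_derive_gradient_line.
move=> t /Hle[_ /(_ d)]; rewrite dotpE mulmxBr mxdotBl mul_mx_scalar mxdotZl.
by rewrite mul0r add0r subr_ge0.
Qed.

Lemma gradient_diff_ge tau :
  (forall t : R, 0 <= t <= 1 -> loewner_ge (hessian f (x + t *: d)) tau%:M) ->
  tau * mxdot d d <= mxdot (gradient f (x + d) - gradient f x) d.
Proof.
move=> Hge.
have := @le_of_derive_le (fun t => - mxdot (gradient f (x + t *: d)) d)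
  (fun t => - mxdot (d *m hessian f (x + t *: d)) d) 0 (- (tau * mxdot d d)).
rewrite scale1r scale0r addr0 mul0r add0r mxdotBl opprK => h.
rewrite -lerN2 opprB addrC; apply: h.
  move=> t _; apply: is_deriveN; exact: is_derive_gradient_line.
move=> t /Hge[_ /(_ d)]; rewrite dotpE mulmxBr mxdotBl mul_mx_scalar mxdotZl.
by rewrite mul0r add0r lerN2 subr_ge0.
Qed.
End Segment.

Section Segment2.
Variables (x d : 'rV[R]_n).

Let sub_segment (P : 'rV[R]_n -> Prop) t s : 0 <= t <= 1 -> 0 <= s <= 1 ->
  (forall t : R, 0 <= t <= 1 -> P (x + t *: d)) -> P (x + s *: (t *: d)).
Proof.
move=> /andP[t0 t1] /andP[s0 s1] Pseg; rewrite scalerA; apply: Pseg.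
by rewrite mulr_ge0//= mulr_ile1.
Qed.

Lemma bregman_le Tau :
  (forall t : R, 0 <= t <= 1 -> loewner_ge Tau%:M (hessian f (x + t *: d))) ->
  bregman f (x + d) x <= Tau / 2 * mxdot d d.
Proof.
move=> Hle.
have := @le_of_derive_le (fun t => f (x + t *: d))
  (fun t => mxdot (gradient f (x + t *: d)) d) (Tau * mxdot d d)
  (mxdot (gradient f x) d).
rewrite scale1r scale0r addr0 /bregman dotpE [x + d]addrC addrK => h.
suff : f (d + x) - f x <= Tau * mxdot d d / 2 + mxdot (gradient f x) d by lra.
apply: h => [t _|t t01]; first exact: is_derive_line.
(* The gradient estimate on the segment to [x + t *: d] is divided by [t], so [t = 0] is apart. *)
have [->|t_neq0] := eqVneq t 0; first by rewrite scale0r addr0 mulr0 add0r.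
have := @gradient_diff_le x (t *: d) Tau.
rewrite mxdotZr mxdotZl mxdotZr mxdotBl mulrCA ler_pM2l ?lt_def ?t_neq0;
  last by lra.
rewrite mulrCA mulrC -lerBlDr; apply => s s01.
exact: (sub_segment (P := fun y => loewner_ge Tau%:M (hessian f y)) t01 s01).
Qed.

Lemma bregman_ge tau :
  (forall t : R, 0 <= t <= 1 -> loewner_ge (hessian f (x + t *: d)) tau%:M) ->
  tau / 2 * mxdot d d <= bregman f (x + d) x.
Proof.
move=> Hge.
have := @le_of_derive_le (fun t => - f (x + t *: d))
  (fun t => - mxdot (gradient f (x + t *: d)) d) (- (tau * mxdot d d))
  (- mxdot (gradient f x) d).
rewrite scale1r scale0r addr0 /bregman dotpE [x + d]addrC addrK => h.
suff : - f (d + x) - - f x <= - (tau * mxdot d d) / 2 - mxdot (gradient f x) d.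
  by lra.
apply: h => [t _|t t01]; first by apply: is_deriveN; exact: is_derive_line.
have [->|t_neq0] := eqVneq t 0; first by rewrite scale0r addr0 mulr0 add0r.
have := @gradient_diff_ge x (t *: d) tau.
rewrite mxdotZr mxdotZl mxdotZr mxdotBl mulrCA ler_pM2l ?lt_def ?t_neq0;
  last by lra.
move=> h; suff : t * (tau * mxdot d d) <=
  mxdot (gradient f (x + t *: d)) d - mxdot (gradient f x) d by lra.
rewrite mulrCA; apply: h => s s01.
exact: (sub_segment (P := fun y => loewner_ge (hessian f y) tau%:M) t01 s01).
Qed.

(** The mean value theorem has no vector form with equality, so the remainder [w] is paired with
    itself and one factor [frob w] is cancelled at the end. *)
Lemma gradient_taylor L : 0 <= L ->
  (forall t : R, 0 <= t <= 1 ->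
    specnorm (hessian f (x + t *: d) - hessian f x) <= L * enorm (t *: d)) ->
  frob (gradient f (x + d) - gradient f x - d *m hessian f x) <=
    L / 2 * mxdot d d.
Proof.
move=> L_ge0 HL; set w := _ - _ - _.
have [->|w_neq0] := eqVneq w 0.
  by rewrite frob0 mulr_ge0 ?mxdot_ge0// divr_ge0.
have w_gt0 : 0 < frob w by rewrite lt_def frob_eq0 w_neq0 frob_ge0.
rewrite -(ler_pM2r w_gt0) -expr2 sqr_frob {1}/w !mxdotBl.
have := @le_of_derive_le (fun t => mxdot (gradient f (x + t *: d)) w)
  (fun t => mxdot (d *m hessian f (x + t *: d)) w)
  (L * mxdot d d * frob w) (mxdot (d *m hessian f x) w).
rewrite scale1r scale0r addr0 => h.
suff : mxdot (gradient f (x + d)) w - mxdot (gradient f x) w <=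
  L * mxdot d d * frob w / 2 + mxdot (d *m hessian f x) w by lra.
apply: h => t t01; first exact: is_derive_gradient_line.
rewrite -lerBlDr -mxdotBl -mulmxBr; apply: le_trans (mxdot_le _ _) _.
rewrite mulrAC ler_wpM2r ?frob_ge0//; apply: le_trans (frob_specnorm _ _) _.
apply: le_trans (ler_wpM2r (frob_ge0 _) (HL t t01)) _.
by rewrite enormE frobZ ger0_norm -?sqr_frob; lra.
Qed.
End Segment2.
End Taylor.

(** * Limits and stationarity *)

Section Limits.
Variable R : realType.

Lemma mx_norm_le_frob m n (X : 'M[R]_(m, n)) : `|X| <= frob X.
Proof.
rewrite [leLHS]mx_normrE; apply/bigmax_leP; split=> [|[i j] _].
  exact: frob_ge0.
exact: entry_le_frob.
Qed.

Lemma geometric_cvg0 (c q : R) : 0 <= q < 1 -> c * q ^+ k @[k --> \oo] --> 0.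
Proof.
by move=> /andP[q0 q1]; apply: cvg_geometric; rewrite ger0_norm.
Qed.

Lemma frob_cvg m n (u : nat -> 'M[R]_(m, n)) l (b : nat -> R) :
  (forall k, frob (u k - l) <= b k) -> b k @[k --> \oo] --> 0 ->
  u k @[k --> \oo] --> l.
Proof.
move=> ub b0; apply/cvgrPdist_le => e e_gt0.
have /cvgrPdist_le/(_ e e_gt0) := b0; apply: filterS => k.
rewrite sub0r normrN => be; apply: le_trans (mx_norm_le_frob _) _.
by rewrite -frobN opprB; apply: le_trans (ub k) (le_trans (ler_norm _) be).
Qed.

Lemma geometric_steps_cvg m n (u : nat -> 'M[R]_(m, n)) (c q : R) :
  0 <= q < 1 -> (forall k, frob (u k.+1 - u k) <= c * q ^+ k) ->
  exists2 l : 'M[R]_(m, n), u k @[k --> \oo] --> l &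
    forall k, frob (u k - l) <= c / (1 - q) * q ^+ k.
Proof.
move=> q01 step; have /andP[q_ge0 q_lt1] := q01.
have p_gt0 : 0 < 1 - q by rewrite subr_gt0.
have c_ge0 : 0 <= c.
  by have := step 0%N; rewrite expr0 mulr1; apply: le_trans (frob_ge0 _).
have tail k p : frob (u (k + p)%N - u k) <= c / (1 - q) * q ^+ k.
  (* The difference of powers is the exact partial geometric sum, which lets the induction on [p]
     close; the stated bound alone would not. *)
  suff h : frob (u (k + p)%N - u k) <= c / (1 - q) * (q ^+ k - q ^+ (k + p)).
    apply: le_trans h _; rewrite ler_wpM2l ?gerBl ?exprn_ge0//.
    by rewrite divr_ge0 // ltW.
  elim: p => [|p IHp]; first by rewrite addn0 !subrr frob0 mulr0.
  have -> : u (k + p.+1)%N - u k =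
      (u (k + p.+1)%N - u (k + p)%N) + (u (k + p)%N - u k).
    by rewrite addrA subrK.
  apply: le_trans (frobD _ _) _; rewrite addnS.
  apply: le_trans (lerD (step _) IHp) _.
  by rewrite exprS le_eqVlt; apply/orP; left; apply/eqP; field; lra.
(* Each entry is a constant plus a telescoping series dominated by a geometric one. *)
have entry_cvg i j : cvgn (fun k => u k i j).
  have -> : (fun k => u k i j) =
      cst (u 0%N i j) + series (telescope (fun k => u k i j)).
    by apply/funext => k; rewrite [LHS](eq_sum_telescope (fun k => u k i j)).
  apply: is_cvgD; first exact: is_cvg_cst.
  apply: normed_cvg; apply: (@series_le_cvg _ _ (geometric c q)) => [k|k|k|].
  - exact: normr_ge0.
  - by rewrite /geometric/= mulr_ge0 ?exprn_ge0.
  - apply: le_trans (step k); rewrite /telescope.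
    by have := entry_le_frob (u k.+1 - u k) i j; rewrite !mxE.
  - by apply: is_cvg_geometric_series; rewrite ger0_norm.
pose l := \matrix_(i, j) lim (u k i j @[k --> \oo]).
have bound k : frob (u k - l) <= c / (1 - q) * q ^+ k.
  have B_ge0 : 0 <= c / (1 - q) * q ^+ k.
    by rewrite mulr_ge0 ?exprn_ge0// divr_ge0// ltW.
  rewrite frob_le//.
  have cv : mxdot (u k - u (k + p)%N) (u k - u (k + p)%N) @[p --> \oo] -->
      mxdot (u k - l) (u k - l).
    rewrite mxdotE; under eq_fun do rewrite mxdotE.
    apply: cvg_big => [|i _]; first exact: add_continuous.
    apply: cvg_big => [|j _]; first exact: add_continuous.
    rewrite !mxE; under eq_fun do rewrite !mxE.
    have cvij : u (k + p)%N i j @[p --> \oo] --> lim (u p i j @[p --> \oo]).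
      under eq_fun do rewrite addnC.
      by apply: (cvg_comp _ _ (cvg_addnr k) (entry_cvg i j)).
    by apply: cvgM; apply: cvgB => //; apply: cvg_cst.
  apply: (cvgr_to_le cv); apply: nearW => p.
  by rewrite -frob_le// -frobN opprB.
by exists l => //; apply: frob_cvg bound _; apply: geometric_cvg0.
Qed.
End Limits.

Section Stationarity.
Variable R : realType.

Lemma derive_min0 (phi : R -> R) (v : R -> R) :
  (forall t : R, is_derive t 1 phi (v t)) -> (forall t, phi 0 <= phi t) ->
  v 0 = 0.
Proof.
move=> dphi phi_min.
have N11 : -1 <= 1 :> R by lra.
have [||t _|_ d0] := @derive1_at_min R phi (-1) 1 0 N11.
- by move=> t _; case: (dphi t).
- by rewrite in_itv/= ltrN10 ltr01.
- exact: phi_min.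
- by case: (dphi 0) => _ <-.
Qed.

(** Along the line from [x] in the direction of the total gradient [g], the derivative at 0 is the
    squared norm of [g]. *)
Lemma sum_gradient_min n (I : finType) (f : I -> 'rV[R]_n -> R) x :
  (forall i y, differentiable (f i) y) ->
  is_minimizer (fun y => \sum_i f i y) x ->
  \sum_i gradient (f i) x = 0.
Proof.
move=> df fmin; set g := \sum_i _; apply/eqP.
rewrite -frob_eq0 -sqrf_eq0 sqr_frob; apply/eqP.
have := @derive_min0 (fun t => \sum_i f i (x + t *: g))
  (fun t => \sum_i mxdot (gradient (f i) (x + t *: g)) g).
rewrite scale0r addr0 -mxdot_suml; apply => [t|t]; last exact: fmin.
have -> : (fun t => \sum_i f i (x + t *: g)) =
    \sum_i (fun t => f i (x + t *: g)).
  by apply/funext => s; rewrite fct_sumE.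
elim/big_ind2: _ => [|? ? ? ? ? ?|i _].
- exact: is_derive_cst.
- exact: is_deriveD.
- exact: is_derive_line.
Qed.

Lemma gradient_min n (f : 'rV[R]_n -> R) x :
  (forall y, differentiable f y) -> is_minimizer f x -> gradient f x = 0.
Proof.
move=> df fmin; have := @sum_gradient_min n 'I_1 (fun=> f) x (fun=> df).
by rewrite big_ord1; apply => y; rewrite !big_ord1.
Qed.

Lemma gradient_half_sqr n (x : 'rV[R]_n) :
  gradient (fun y => 2^-1 * dotp y y) x = x.
Proof.
apply/rowP => j; rewrite mxE /derive.
have -> : (fun h : R => h^-1 *:
  (((fun y : 'rV[R]_n => 2^-1 * dotp y y) \o shift x) (h *: delta_mx 0 j) -
   2^-1 * dotp x x)) =
  (fun h => h^-1 * (h * (x 0 j + h / 2))).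
  apply/funext => h /=; congr (_ * _).
  have e1 : mxdot (delta_mx 0 j : 'rV[R]_n) (delta_mx 0 j) = 1.
    rewrite mxdotE big_ord1 (bigD1 j)//= big1.
      by rewrite ?mxE ?eqxx ?mulr1 ?addr0.
    by move=> k kj; rewrite !mxE (negPf kj) andbF mulr0.
  have e2 : mxdot x (delta_mx 0 j : 'rV[R]_n) = x 0 j.
    rewrite mxdotE big_ord1 (bigD1 j)//= big1.
      by rewrite ?mxE ?eqxx ?mulr1 ?addr0.
    by move=> k kj; rewrite !mxE (negPf kj) andbF mulr0.
  rewrite !dotpE !(mxdotDl, mxdotDr, mxdotZl, mxdotZr) (mxdotC _ x) e1 e2.
  by field.
apply/cvg_lim => //.
have cv : x 0 j + h / 2 @[h --> 0^'] --> x 0 j.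
  have : (x 0 j + h / 2) @[h --> (0 : R)] --> x 0 j + 0 / 2.
    apply: cvgD; first exact: cvg_cst.
    by apply: cvgM; [exact: cvg_id | exact: cvg_cst].
  by rewrite mul0r addr0; apply: cvg_within_filter.
apply: cvg_trans cv; apply: near_eq_cvg; near=> h.
by rewrite mulKf//; near: h; exact: nbhs_dnbhs_neq.
Unshelve. all: by end_near.
Qed.
End Stationarity.

(** * Inverse Hessians *)

Section Loewner.
Variables (R : realType) (n : nat).
Implicit Types (H : 'M[R]_n) (v : 'rV[R]_n).

Lemma loewner_ge_form H (tau : R) v :
  loewner_ge H tau%:M -> tau * mxdot v v <= mxdot (v *m H) v.
Proof.
move=> [_ /(_ v)]; rewrite dotpE mulmxBr mxdotBl mul_mx_scalar mxdotZl.
by rewrite subr_ge0.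
Qed.

Lemma loewner_le_form H (Tau : R) v :
  loewner_ge Tau%:M H -> mxdot (v *m H) v <= Tau * mxdot v v.
Proof.
move=> [_ /(_ v)]; rewrite dotpE mulmxBr mxdotBl mul_mx_scalar mxdotZl.
by rewrite subr_ge0.
Qed.

Lemma loewner_ge_sym H (tau : R) : loewner_ge H tau%:M -> H^T = H.
Proof.
move=> [sym _]; rewrite -[H](subrK tau%:M) [LHS]raddfD/= sym.
by rewrite tr_scalar_mx.
Qed.

Lemma loewner_ge_unit H (tau : R) :
  0 < tau -> loewner_ge H tau%:M -> H \in unitmx.
Proof.
move=> tau_gt0 Hge; rewrite -row_free_unit -kermx_eq0.
apply/eqP/row_matrixP => i; apply/eqP.
rewrite row0 -frob_eq0 -sqrf_eq0 sqr_frob.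
have := loewner_ge_form (row i (kermx H)) Hge.
rewrite -row_mul mulmx_ker row0 mxdot0l pmulr_rle0// => h.
by apply/eqP/le_anti; rewrite h mxdot_ge0.
Qed.

(** With [v = w *m H], the lower bound is [ip_psd_norm] for [H]; the upper one combines
    Cauchy-Schwarz for [w] and [v] with [tau |w|^2 <= <w, v>]. *)
Lemma loewner_inv_bounds H (tau Tau : R) v : 0 < tau -> 0 < Tau ->
  loewner_ge H tau%:M -> loewner_ge Tau%:M H ->
  Tau^-1 * mxdot v v <= mxdot (v *m invmx H) v <= tau^-1 * mxdot v v.
Proof.
move=> tau_gt0 Tau_gt0 Hge Hle; have uH := loewner_ge_unit tau_gt0 Hge.
have symH := loewner_ge_sym Hge.
set w := v *m invmx H; have vE : v = w *m H by rewrite mulmxKV.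
have p_ge : tau * mxdot w w <= mxdot w v.
  by rewrite mxdotC vE; exact: loewner_ge_form.
have p_ge0 : 0 <= mxdot w v.
  by apply: le_trans p_ge; rewrite mulr_ge0 ?mxdot_ge0 ?ltW.
apply/andP; split.
  rewrite mulrC ler_pdivrMr// [_ * Tau]mulrC.
  suff : mxdot (w *m H) (w *m H) <= Tau * mxdot (w *m H) w.
    by rewrite -vE (mxdotC v w).
  apply: (@ip_psd_norm _ _ (@mxdot R 1 n) (mulmxr H)) => //.
  - exact: mxdot_semi_inner.
  - by move=> u z /=; rewrite mxdot_adjr symH.
  - by move=> a u z /=; rewrite mulmxDl -scalemxAl.
  - exact: ltW.
  - move=> u /=; rewrite loewner_le_form// andbT.
    apply: le_trans (loewner_ge_form u Hge).
    by rewrite mulr_ge0 ?mxdot_ge0 ?ltW.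
rewrite mulrC ler_pdivlMr//.
have [p0|p_neq0] := eqVneq (mxdot w v) 0; first by rewrite p0 mul0r mxdot_ge0.
have p_gt0 : 0 < mxdot w v by rewrite lt_def p_neq0.
rewrite -(ler_pM2l p_gt0) mulrA -expr2.
have cs := ip_cauchy_schwarz (mxdot_semi_inner R 1 n) w v.
apply: le_trans (ler_wpM2r (ltW tau_gt0) cs) _.
by rewrite mulrAC [_ * tau]mulrC ler_wpM2r// mxdot_ge0.
Qed.

Lemma loewner_frob_ge H (tau : R) v : 0 < tau -> loewner_ge H tau%:M ->
  tau ^+ 2 * mxdot v v <= mxdot (v *m H) (v *m H).
Proof.
move=> tau_gt0 Hge.
have h1 := loewner_ge_form v Hge; have h2 := mxdot_le (v *m H) v.
rewrite -!sqr_frob -exprMn ler_sqr ?nnegrE ?mulr_ge0 ?frob_ge0 ?(ltW tau_gt0)//.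
have [v0|v_neq0] := eqVneq (frob v) 0; first by rewrite v0 mulr0 frob_ge0.
have v_gt0 : 0 < frob v by rewrite lt_def v_neq0 frob_ge0.
rewrite -(ler_pM2r v_gt0); apply: le_trans h2; apply: le_trans h1.
by rewrite -mulrA -expr2 sqr_frob.
Qed.
End Loewner.

(** * Block diagonal operators *)

Section BlockDiagonal.
Variables (R : realType) (N n : nat) (K : 'I_N -> 'M[R]_n).

Definition rowwise (X : 'M[R]_(N, n)) : 'M[R]_(N, n) :=
  \matrix_(i < N) (row i X *m K i).

Lemma rowwise_lin a X Y : rowwise (a *: X + Y) = a *: rowwise X + rowwise Y.
Proof.
apply/row_matrixP => i; rewrite linearD linearZ /= !rowK.
by rewrite linearD linearZ mulmxDl scalemxAl.
Qed.

Lemma rowwise_dot X Y :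
  mxdot (rowwise X) Y = \sum_i mxdot (row i X *m K i) (row i Y).
Proof. by rewrite mxdot_row; apply: eq_bigr => i _; rewrite rowK. Qed.

Lemma rowwise_sym X Y : (forall i, (K i)^T = K i) ->
  mxdot (rowwise X) Y = mxdot X (rowwise Y).
Proof.
move=> symK; rewrite [RHS]mxdotC !rowwise_dot; apply: eq_bigr => i _.
by rewrite mxdot_adjr symK mxdotC.
Qed.
End BlockDiagonal.

(** * Cauchy-Schwarz for weighted sums *)

Section Weighted.
Variable R : realType.

(** Lagrange's identity: the defect is half the double sum of [(b i - b j) ^+ 2]. *)
Lemma sqr_sum_le (I : finType) (A : {set I}) (b : I -> R) :
  (\sum_(i in A) b i) ^+ 2 <= #|A|%:R * \sum_(i in A) b i ^+ 2.
Proof.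
have h : 0 <= \sum_(i in A) \sum_(j in A) (b i - b j) ^+ 2.
  by do 2!apply: sumr_ge0 => ? _; exact: sqr_ge0.
have -> : (\sum_(i in A) b i) ^+ 2 = \sum_(i in A) \sum_(j in A) b i * b j.
  by rewrite expr2 mulr_suml; apply: eq_bigr => i _; rewrite mulr_sumr.
have e : \sum_(i in A) \sum_(j in A) (b i - b j) ^+ 2 =
    2 * (#|A|%:R * \sum_(i in A) b i ^+ 2) -
    2 * \sum_(i in A) \sum_(j in A) b i * b j.
  have -> : 2 * (#|A|%:R * \sum_(i in A) b i ^+ 2) =
      \sum_(i in A) \sum_(j in A) (b i ^+ 2 + b j ^+ 2).
    under [RHS]eq_bigr => i _ do rewrite big_split/= sumr_const.
    by rewrite big_split/= sumrMnl sumr_const -mulr2n !mulr_natl.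
  rewrite mulr_sumr -sumrB; apply: eq_bigr => i _.
  by rewrite mulr_sumr -sumrB; apply: eq_bigr => j _; ring.
by move: h; rewrite e; lra.
Qed.

Lemma sqr_frob_weighted_sum_le m n (I : finType) (A : {set I}) (w : I -> R)
    (a : R) (X : I -> 'M[R]_(m, n)) : (forall i, i \in A -> 0 <= w i <= a) ->
  mxdot (\sum_(i in A) w i *: X i) (\sum_(i in A) w i *: X i) <=
    #|A|%:R * a * \sum_(i in A) w i * mxdot (X i) (X i).
Proof.
move=> wa; rewrite -sqr_frob.
apply: (@le_trans _ _ ((\sum_(i in A) w i * frob (X i)) ^+ 2)).
  rewrite ler_sqr ?nnegrE ?frob_ge0//; last first.
    by apply: sumr_ge0 => i /wa/andP[w0 _]; rewrite mulr_ge0 ?frob_ge0.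
  apply: le_trans (frob_sum _ _) _; apply: ler_sum => i /wa/andP[w0 _].
  by rewrite frobZ ger0_norm.
apply: le_trans (sqr_sum_le _ _) _; rewrite -mulrA ler_wpM2l//.
rewrite mulr_sumr; apply: ler_sum => i /wa/andP[w0 wa'].
by rewrite exprMn sqr_frob expr2 -mulrA ler_wpM2r// mulr_ge0 ?mxdot_ge0.
Qed.
End Weighted.

(** * Decrease of the Lyapunov function *)

Section LyapunovStep.
Variables (R : realType) (N n : nat) (E : {set {set 'I_N}}).
Hypothesis no_loop : forall i, link i i \notin E.
Variables (f : 'I_N -> 'rV[R]_n -> R) (xstar : 'rV[R]_n).
Hypotheses (df : forall i x, differentiable (f i) x)
  (dg : forall i x, differentiable (gradient (f i)) x).
Variable alpha : {set 'I_N} -> R.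

(** The three-point identity of Bregman divergences. *)
Lemma bregman_step (i : 'I_N) (x d : 'rV[R]_n) :
  bregman (f i) xstar (x + d) = bregman (f i) xstar x +
    bregman (f i) x (x + d) -
    mxdot (gradient (f i) (x + d) - gradient (f i) x) (xstar - x).
Proof.
rewrite /bregman !dotpE.
have -> : xstar - (x + d) = (xstar - x) + (x - (x + d)).
  by rewrite addrA subrK.
by rewrite mxdotDr mxdotBl; ring.
Qed.

(** Origin of the denominator in [rho]. Row [i] of [W X] is a weighted sum of differences to the
    neighbours, so weighted Cauchy-Schwarz costs degree times maximal weight; the factor 2 matches
    the 1/2 of [wlap_form]. *)
Lemma consensus_force (X : 'M[R]_(N, n)) (a : 'I_N -> R) :
  (forall i j, j \in nbrs E i -> 0 <= alpha (link i j) <= a i) ->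
  (forall i, 0 < #|nbrs E i|%:R * a i) ->
  \sum_i mxdot (row i (wlap E alpha *m X)) (row i (wlap E alpha *m X)) /
     (2 * (#|nbrs E i|%:R * a i)) <= mxdot (wlap E alpha *m X) X.
Proof.
move=> alpha_le a_gt0; rewrite wlap_form// mulr_sumr; apply: ler_sum => i _.
rewrite row_wlap// invfM mulrCA ler_pM2l// ler_pdivrMr// mulrC.
exact: sqr_frob_weighted_sum_le (alpha_le i).
Qed.

(** The curvature constants along the segment are parameters because the estimate is used twice:
    with the constants of [C'] to prove invariance, then with those of [C] to obtain [rho]. *)
Lemma lyapunov_step (X D : 'M[R]_(N, n)) (a th Th L r : 'I_N -> R) :
  (forall i j, j \in nbrs E i -> 0 <= alpha (link i j) <= a i) ->
  (forall i, 0 < #|nbrs E i|%:R * a i) ->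
  (forall i,
     row i D *m hessian (f i) (row i X) = - row i (wlap E alpha *m X)) ->
  (forall i, 0 < th i) ->
  (forall i, loewner_ge (hessian (f i) (row i X)) (th i)%:M) ->
  (forall i (t : R), 0 <= t <= 1 ->
     loewner_ge (Th i)%:M (hessian (f i) (row i X + t *: row i D))) ->
  (forall i, 0 <= L i) ->
  (forall i (t : R), 0 <= t <= 1 ->
     specnorm (hessian (f i) (row i X + t *: row i D) - hessian (f i) (row i X))
       <= L i * enorm (t *: row i D)) ->
  (forall i, frob (xstar - row i X) <= r i) ->
  lyapunov f xstar (fun i => row i X + row i D) +
    \sum_i (th i ^+ 2 / (2 * (#|nbrs E i|%:R * a i)) - Th i / 2 - L i / 2 * r i)
           * mxdot (row i D) (row i D) <=
  lyapunov f xstar (fun i => row i X).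
Proof.
move=> alpha_le a_gt0 DH th_gt0 Hge Hle L_ge0 HL Xr.
set s := wlap E alpha *m X in DH *.
have force := consensus_force X alpha_le a_gt0; rewrite -/s in force.
(* The symmetric [W] kills matrices with equal rows, so [xstar] may be subtracted from every row;
   this produces the cross term of the three-point identity. *)
have sX : mxdot s X = \sum_i mxdot (row i s) (row i X - xstar).
  have -> : mxdot s X = mxdot s (X - \matrix_(i < N) xstar).
    rewrite mxdotBr /s [X in _ - X]mxdot_adjl wlap_sym wlap_const//.
    by rewrite mxdot0r subr0.
  by rewrite mxdot_row; apply: eq_bigr => i _; rewrite linearB/= rowK.
rewrite sX in force.
have step i : bregman (f i) xstar (row i X + row i D) +
    (th i ^+ 2 / (2 * (#|nbrs E i|%:R * a i)) - Th i / 2 - L i / 2 * r i)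
           * mxdot (row i D) (row i D) <=
    bregman (f i) xstar (row i X) +
    (mxdot (row i s) (row i s) / (2 * (#|nbrs E i|%:R * a i)) -
     mxdot (row i s) (row i X - xstar)).
  set x := row i X; set d := row i D; set m := mxdot d d.
  rewrite bregman_step.
  have h1 : bregman (f i) x (x + d) <= Th i / 2 * m.
    (* The divergence is based at the new point, so the segment is run backwards. *)
    have := @bregman_le _ _ (f i) (df i) (dg i) (x + d) (- d) (Th i).
    rewrite addrK mxdotNl mxdotNr opprK; apply => t /andP[t0 t1].
    have -> : x + d + t *: - d = x + (1 - t) *: d.
      by rewrite scalerN scalerBl scale1r addrA.
    by apply: Hle; rewrite subr_ge0 t1 gerBl.
  have h2 := gradient_taylor (dg i) (L_ge0 i) (HL i).
  rewrite -/x -/d -/m DH -/s opprK in h2.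
  (* By the Newton equation the gradient changes by minus the force [row i s], up to the Taylor
     remainder [e]; [e] is paired with a vector of length at most [r i]. *)
  have h3 : - mxdot (gradient (f i) (x + d) - gradient (f i) x) (xstar - x) <=
      - mxdot (row i s) (x - xstar) + L i / 2 * r i * m.
    set e := _ + row i s in h2.
    have -> : gradient (f i) (x + d) - gradient (f i) x = e - row i s.
      by rewrite /e addrK.
    rewrite mxdotBl opprB lerD//.
      by rewrite -[x - xstar]opprB mxdotNr opprK.
    rewrite -mxdotNl; apply: le_trans (mxdot_le _ _) _; rewrite frobN.
    apply: le_trans (ler_pM (frob_ge0 _) (frob_ge0 _) h2 (Xr i)) _.
    by rewrite mulrAC.
  have h4 : th i ^+ 2 / (2 * (#|nbrs E i|%:R * a i)) * m <=
      mxdot (row i s) (row i s) / (2 * (#|nbrs E i|%:R * a i)).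
    rewrite mulrAC ler_pM2r; last by rewrite invr_gt0 pmulr_rgt0.
    have := loewner_frob_ge d (th_gt0 i) (Hge i).
    by rewrite -/x DH mxdotNl mxdotNr opprK.
  by lra.
rewrite /lyapunov -big_split/=.
apply: (le_trans (ler_sum _ (fun i _ => step i))).
by rewrite big_split/= gerDl sumrB subr_le0.
Qed.
End LyapunovStep.

(** * Invariance of the sublevel sets *)

Section Bregman.
Variables (R : realType) (n : nat).
Implicit Types (f : 'rV[R]_n -> R) (C : set 'rV[R]_n).

Lemma conv_hull_sub C : C `<=` conv_hull C.
Proof. exact: sub_smallest. Qed.

Lemma conv_hull_segment C (x y : 'rV[R]_n) (t : R) : 0 <= t <= 1 ->
  conv_hull C x -> conv_hull C y -> conv_hull C (x + t *: (y - x)).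
Proof.
move=> t01 Cx Cy A [convA CA].
have Ax := Cx A (conj convA CA); have Ay := Cy A (conj convA CA).
have /andP[t0 t1] := t01.
have := convA y x (Itv01 t0 t1) (mem_set Ay) (mem_set Ax).
move/set_mem; congr (A _); rewrite /conv /=.
by rewrite /unstable.onem scalerBr scalerBl scale1r addrCA.
Qed.

(* A singleton is convex and compact. *)
Lemma strongly_convex_loewner f x : locally_strongly_convex f ->
  exists2 th : R, 0 < th & loewner_ge (hessian f x) th%:M.
Proof.
move=> /(_ [set x]) [||th th_gt0 /(_ x erefl)]; last by exists th.
- by move=> y z t /set_mem -> /set_mem ->; apply/mem_set; rewrite convmm.
- exact: compact_set1.
Qed.

Hypothesis n_gt0 : (0 < n)%N.

(** Both bounds are tested on one nonzero vector, which exists because [0 < n]. *)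
Lemma loewner_scalar_le (H : 'M[R]_n) (tau Tau : R) :
  loewner_ge H tau%:M -> loewner_ge Tau%:M H -> tau <= Tau.
Proof.
move=> Hge Hle; pose v := const_mx 1 : 'rV[R]_n.
have := le_trans (loewner_ge_form v Hge) (loewner_le_form v Hle).
rewrite ler_pM2r// lt_def mxdot_ge0 -sqr_frob expf_neq0// frob_eq0.
apply/eqP => /rowP/(_ (Ordinal n_gt0)); rewrite !mxE => /eqP.
by rewrite oner_eq0.
Qed.

Variable f : 'rV[R]_n -> R.
Hypotheses (df : forall x, differentiable f x)
  (dg : forall x, differentiable (gradient f) x).

Lemma bregman_xx x : bregman f x x = 0.
Proof. by rewrite /bregman !subrr dotpE mxdot0r subr0. Qed.

(** Only positivity of the Hessian at each point of the segment matters here, so the lower quadratic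
    bound is taken with constant 0. *)
Lemma bregman_ge0 x y : locally_strongly_convex f -> 0 <= bregman f y x.
Proof.
move=> fconv; have := @bregman_ge _ _ f df dg x (y - x) 0.
rewrite mul0r mul0r [x + (y - x)]addrC subrK; apply => t _.
have [th th_gt0 [sym pos]] := strongly_convex_loewner (x + t *: (y - x)) fconv.
have symH := @loewner_ge_sym _ _ _ th (conj sym pos).
split; first by rewrite linearB/= symH tr_scalar_mx.
move=> v; have := loewner_ge_form v (conj sym pos).
rewrite raddf0 subr0 dotpE; apply: le_trans.
by rewrite mulr_ge0 ?mxdot_ge0// ltW.
Qed.

(** Origin of the radius [sqrt (2 V / th)]: the divergence dominates [th / 2] times the squared
    distance as soon as the segment stays in the hull. *)
Lemma bregman_dist_le C (V th Th : R) x y : 0 < th ->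
  hessian_bounds f (conv_hull C) th Th -> C x -> C y -> bregman f y x <= V ->
  frob (y - x) <= Num.sqrt (2 * V / th).
Proof.
move=> th_gt0 fC Cx Cy xV; have := @bregman_ge _ _ f df dg x (y - x) th.
rewrite [x + (y - x)]addrC subrK => h.
have {}h : th / 2 * mxdot (y - x) (y - x) <= V.
  apply: le_trans xV; apply: h => t t01.
  have := conv_hull_segment t01 (conv_hull_sub Cx) (conv_hull_sub Cy).
  by move=> /fC[].
have h' : mxdot (y - x) (y - x) <= 2 * V / th.
  by rewrite ler_pdivlMr// mulrC; lra.
by rewrite /frob ler_sqrt// (le_trans (mxdot_ge0 _) h').
Qed.
End Bregman.

(** * Step sizes, displacement and decrease along the orbit *)

Section Orbit.
Variables (R : realType) (N n : nat) (E : {set {set 'I_N}}).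
Hypotheses (n_gt0 : (0 < n)%N) (no_loop : forall i, link i i \notin E)
  (nbrs_gt0 : forall i, (0 < #|nbrs E i|)%N).
Variables (f : 'I_N -> 'rV[R]_n -> R) (xstar : 'rV[R]_n) (V0 : R).
Hypotheses (df : forall i x, differentiable (f i) x)
  (dg : forall i x, differentiable (gradient (f i)) x)
  (f_convex : forall i, locally_strongly_convex (f i))
  (V0_ge0 : 0 <= V0).
Local Notation C := (sublevel f xstar V0).

Variables (th Th L th' Th' L' : 'I_N -> R) (abar : R).
Local Notation r i := (Num.sqrt (2 * V0 / th i)).
Local Notation C' i := (enlarge (C i) (delta E (fun=> 1) th abar V0 i)).
Hypotheses (th_gt0 : forall i, 0 < th i)
  (thTh : forall i, hessian_bounds (f i) (conv_hull (C i)) (th i) (Th i))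
  (L_ge0 : forall i, 0 <= L i)
  (L_lip : forall i, lipschitz_mx_on (conv_hull (C i)) (L i) (hessian (f i)))
  (th'_gt0 : forall i, 0 < th' i)
  (th'Th' : forall i, hessian_bounds (f i) (C' i) (th' i) (Th' i))
  (L'_ge0 : forall i, 0 <= L' i)
  (L'_lip : forall i, lipschitz_mx_on (C' i) (L' i) (hessian (f i)))
  (Th'_ge : forall i, Th i <= Th' i)
  (th'_le : forall i, th' i <= th i)
  (L'_ge : forall i, L i <= L' i).

Variable alpha : {set 'I_N} -> R.
Hypotheses (alpha_abar : forall e, e \in E -> 0 < alpha e <= abar)
  (alpha_lt : forall i j, link i j \in E ->
     alpha (link i j) < 1 / (2 * 1) * step_bound E th th' Th' L' V0 i).
Local Notation a i := (fmax (nbrs E i) (fun j => alpha (link i j))).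
Local Notation W := (wlap E alpha).

Lemma fmax_alphaP i :
  (exists2 j, link i j \in E & a i = alpha (link i j)) /\
  forall j, link i j \in E -> alpha (link i j) <= a i.
Proof.
have /fmaxP-/(_ R (fun j => alpha (link i j))) : nbrs E i != finset.set0.
  by rewrite -card_gt0.
move=> [[j ij ->] le_a]; split; first by exists j; rewrite ?inE in ij *.
by move=> k ik; apply: le_a; rewrite inE.
Qed.

Lemma nbrs_alpha_gt0 i : 0 < #|nbrs E i|%:R * a i.
Proof.
have [[j ij ->] _] := fmax_alphaP i.
by rewrite mulr_gt0 ?ltr0n//; have /andP[] := alpha_abar ij.
Qed.

Lemma nbrs_alpha i j : j \in nbrs E i -> 0 <= alpha (link i j) <= a i.
Proof.
rewrite inE => ij; have [_ /(_ _ ij) ->] := fmax_alphaP i.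
by rewrite andbT; have /andP[/ltW] := alpha_abar ij.
Qed.

Lemma sublevel_xstar i : C i xstar.
Proof. by rewrite /sublevel/= bregman_xx. Qed.

Lemma enlarge_mem i x d : C i x -> frob d <= delta E (fun=> 1) th abar V0 i ->
  C' i (x + d).
Proof.
move=> Cx dle; apply: conv_hull_sub; exists x => //.
by rewrite addrAC subrr add0r enormE.
Qed.

Lemma delta_ge0 i : 0 <= delta E (fun=> 1) th abar V0 i.
Proof.
have [[j ij _] _] := fmax_alphaP i.
have /andP[a0 /(lt_le_trans a0)/ltW abar_ge0] := alpha_abar ij.
apply: mulr_ge0; first by rewrite divr_ge0// ltW.
apply: sumr_ge0 => k _.
by rewrite mul1r addr_ge0 ?sqrtr_ge0.
Qed.

Lemma th_le_Th i : th i <= Th i.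
Proof.
have [Hle Hge] := thTh (conv_hull_sub (sublevel_xstar i)).
exact: loewner_scalar_le Hge Hle.
Qed.

Lemma th'_le_Th' i : th' i <= Th' i.
Proof.
have x'C : C' i (xstar + 0).
  by apply: enlarge_mem; [exact: sublevel_xstar | rewrite frob0 delta_ge0].
have [Hle Hge] := th'Th' x'C; exact: loewner_scalar_le Hge Hle.
Qed.

(** The condition on [alpha] is read at the link attaining [a i]. Clearing the inverse in
    [step_bound] needs a positive bracket, which [th' i <= Th' i] provides. *)
Lemma step_size_lt i : Th' i - th' i / 2 + L' i / 2 * r i <
  th i ^+ 2 / (2 * (#|nbrs E i|%:R * a i)).
Proof.
have [[j ij aj] _] := fmax_alphaP i; have := alpha_lt ij.
have := nbrs_alpha_gt0 i; rewrite aj => na_gt0; rewrite /step_bound.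
set B := _ + _ * r i.
have B_gt0 : 0 < B.
  have := th'_gt0 i; have := th'_le_Th' i.
  have : 0 <= L' i / 2 * r i by rewrite mulr_ge0 ?sqrtr_ge0 ?divr_ge0.
  by rewrite /B; lra.
have N_gt0 : 0 < #|nbrs E i|%:R :> R by rewrite ltr0n.
have a_gt0 : 0 < alpha (link i j) by have /andP[] := alpha_abar ij.
move=> h; rewrite ltr_pdivlMr ?mulr_gt0//.
have -> : th i ^+ 2 = 2 * B * #|nbrs E i|%:R *
    (1 / (2 * 1) * (th i ^+ 2 / #|nbrs E i|%:R * B^-1)).
  by field; rewrite !gt_eqF.
by rewrite [ltLHS](_ : _ = 2 * B * #|nbrs E i|%:R * alpha (link i j));
  [rewrite ltr_pM2l ?mulr_gt0 | ring].
Qed.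

(** Passing from the primed to the unprimed constants only decreases the left side of
    [step_size_lt]. *)
Lemma rho_gt0 i : 0 < rho E alpha th Th L V0 i.
Proof.
rewrite /rho; have := step_size_lt i; rewrite mulrA.
have : L i / 2 * r i <= L' i / 2 * r i.
  by rewrite ler_wpM2r ?sqrtr_ge0 ?ler_pM2r.
by have := Th'_ge i; have := th'_le i; lra.
Qed.

Variable X : nat -> 'M[R]_(N, n).
Hypotheses (X0 : lyapunov f xstar (fun i => row i (X 0%N)) <= V0)
  (XS : forall k i, row i (X k.+1) = row i (X k) -
     row i (W *m X k) *m invmx (hessian (f i) (row i (X k)))).

Lemma lyapunov_le_mem x i :
  lyapunov f xstar x <= V0 -> C i (x i).
Proof.
apply: le_trans; rewrite /lyapunov (bigD1 i)//= lerDl.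
by apply: sumr_ge0 => j _; apply: bregman_ge0.
Qed.

Lemma sublevel_hessian i x : C i x ->
  loewner_ge (Th i)%:M (hessian (f i) x) /\
  loewner_ge (hessian (f i) x) (th i)%:M.
Proof. by move=> Cx; exact: (thTh (conv_hull_sub Cx)). Qed.

Lemma sublevel_dist i x : C i x -> frob (xstar - x) <= r i.
Proof.
move=> Cx; apply: (bregman_dist_le (df i) (dg i) (th_gt0 i) (@thTh i) Cx) => //.
exact: sublevel_xstar.
Qed.

Lemma sublevel_dist_le i j x y : C i x -> C j y -> frob (x - y) <= r i + r j.
Proof.
move=> /sublevel_dist Cx /sublevel_dist Cy.
have -> : x - y = (xstar - y) - (xstar - x).
  by rewrite opprB [RHS]addrC addrA subrK.
by apply: le_trans (frobB _ _) _; rewrite addrC lerD.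
Qed.

Section OneStep.
Variable k : nat.
Hypothesis XC : forall i, C i (row i (X k)).
Variable D : 'M[R]_(N, n).
Hypothesis DE : D = X k.+1 - X k.

Lemma displacement_hessian i :
  row i D *m hessian (f i) (row i (X k)) = - row i (W *m X k).
Proof.
have [_ Hge] := sublevel_hessian (XC i).
rewrite DE linearB/= XS addrAC subrr add0r mulNmx mulmxKV//.
exact: loewner_ge_unit Hge.
Qed.

(** Origin of [delta]: [th i] times the displacement is at most the force, a sum over neighbours of
    at most [abar] times [|x_i - x_j|], and both points are within their radius of [xstar]. *)
Lemma displacement_le i : frob (row i D) <= delta E (fun=> 1) th abar V0 i.
Proof.
have [_ Hge] := sublevel_hessian (XC i).
have := loewner_frob_ge (row i D) (th_gt0 i) Hge.
rewrite displacement_hessian mxdotNl mxdotNr opprK -!sqr_frob -exprMn.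
rewrite ler_sqr ?nnegrE ?mulr_ge0 ?frob_ge0 ?(ltW (th_gt0 i))// => h.
rewrite /delta mulrAC ler_pdivlMr// mulrC; apply: le_trans h _.
rewrite row_wlap// mulr_sumr; apply: le_trans (frob_sum _ _) _.
apply: ler_sum => j; rewrite inE => ij; have /andP[a0 ale] := alpha_abar ij.
rewrite frobZ gtr0_norm// mul1r ler_pM ?frob_ge0 ?(ltW a0)//.
exact: sublevel_dist_le.
Qed.

Lemma displacement_mem i (t : R) : 0 <= t <= 1 ->
  C' i (row i (X k) + t *: row i D).
Proof.
move=> /andP[t0 t1]; apply: enlarge_mem => //.
rewrite frobZ ger0_norm//; apply: le_trans (displacement_le i).
by rewrite ler_piMl ?frob_ge0.
Qed.

Let lyapunov_stepE :
  lyapunov f xstar (fun i => row i (X k.+1)) =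
  lyapunov f xstar (fun i => row i (X k) + row i D).
Proof. by apply: eq_bigr => i _; rewrite DE linearB/= addrC subrK. Qed.

(** Only [X k] is known to lie in the sublevel sets. Hence [th] and the radius, which concern [X k]
    alone, come from [C], while the bounds along the segment come from [C']. *)
Lemma orbit_step_le : lyapunov f xstar (fun i => row i (X k.+1)) <=
  lyapunov f xstar (fun i => row i (X k)).
Proof.
have L'lip i (t : R) : 0 <= t <= 1 ->
    specnorm (hessian (f i) (row i (X k) + t *: row i D) -
              hessian (f i) (row i (X k))) <= L' i * enorm (t *: row i D).
  move=> t01; have xC' : C' i (row i (X k)).
    have := @displacement_mem i 0; rewrite scale0r addr0; apply.
    by rewrite lexx ler01.
  have := L'_lip (@displacement_mem i t t01) xC'.
  by rewrite [row i (X k) + _]addrC addrK.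
have := lyapunov_step no_loop df dg nbrs_alpha nbrs_alpha_gt0
  displacement_hessian th_gt0 (fun i => proj2 (sublevel_hessian (XC i)))
  (fun i t t01 => proj1 (th'Th' (@displacement_mem i t t01))) L'_ge0 L'lip
  (fun i => sublevel_dist (XC i)).
rewrite lyapunov_stepE; apply: le_trans; rewrite lerDl.
apply: sumr_ge0 => i _; rewrite mulr_ge0 ?mxdot_ge0//.
(* [step_size_lt] controls [Th' - th' / 2], which dominates the needed [Th' / 2] since
   [th' <= Th']. *)
by have := step_size_lt i; have := th'_le_Th' i; lra.
Qed.

(** With both ends in [C i] the segment lies in its hull, so the sharper constants apply. *)
Lemma orbit_step_rho : (forall i, C i (row i (X k.+1))) ->
  lyapunov f xstar (fun i => row i (X k.+1)) +
    \sum_i rho E alpha th Th L V0 i * mxdot (row i D) (row i D) <=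
  lyapunov f xstar (fun i => row i (X k)).
Proof.
move=> XC'.
have seg i (t : R) : 0 <= t <= 1 ->
    conv_hull (C i) (row i (X k) + t *: row i D).
  move=> t01; rewrite DE linearB/=.
  by apply: conv_hull_segment => //; apply: conv_hull_sub.
have Llip i (t : R) : 0 <= t <= 1 ->
    specnorm (hessian (f i) (row i (X k) + t *: row i D) -
              hessian (f i) (row i (X k))) <= L i * enorm (t *: row i D).
  move=> t01; have := L_lip (@seg i t t01) (conv_hull_sub (XC i)).
  by rewrite [row i (X k) + _]addrC addrK.
have := lyapunov_step no_loop df dg nbrs_alpha nbrs_alpha_gt0
  displacement_hessian th_gt0 (fun i => proj2 (sublevel_hessian (XC i)))
  (fun i t t01 => proj1 (thTh (@seg i t t01))) L_ge0 Llip
  (fun i => sublevel_dist (XC i)).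
rewrite lyapunov_stepE; apply: le_trans; rewrite lerD2l.
apply: ler_sum => i _; rewrite ler_wpM2r ?mxdot_ge0// /rho mulrA.
(* [rho] contains [th / 2 - Th], which is at most the [- Th / 2] of [lyapunov_step]. *)
by have := th_le_Th i; lra.
Qed.
End OneStep.

Lemma orbit_lyapunov_le k : lyapunov f xstar (fun i => row i (X k)) <= V0.
Proof.
elim: k => [|k IHk]//; apply: (le_trans _ IHk).
apply: (orbit_step_le _ erefl) => i.
exact: (@lyapunov_le_mem (fun i => row i (X k)) i IHk).
Qed.

Lemma orbit_mem k i : C i (row i (X k)).
Proof.
exact: (@lyapunov_le_mem (fun i => row i (X k)) i (orbit_lyapunov_le k)).
Qed.

Lemma orbit_decrease k : lyapunov f xstar (fun i => row i (X k.+1)) +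
    \sum_i rho E alpha th Th L V0 i *
      mxdot (row i (X k.+1 - X k)) (row i (X k.+1 - X k)) <=
  lyapunov f xstar (fun i => row i (X k)).
Proof. by apply: (orbit_step_rho _ erefl) => i; apply: orbit_mem. Qed.
End Orbit.

(** * Linear convergence *)

Section LinearConvergence.
Variables (R : realType) (N n : nat) (E : {set {set 'I_N}}).
Hypotheses (N_ge2 : (2 <= N)%N) (no_loop : forall i, link i i \notin E)
  (E_connected : connected_graph E).
Variable alpha : {set 'I_N} -> R.
Variables amin amax : R.
Hypotheses (amin_gt0 : 0 < amin)
  (alpha_bounds : forall e, e \in E -> amin <= alpha e <= amax).
Local Notation W := (wlap E alpha).
Local Notation lmax := (lambda_max (laplacian R E)).
Local Notation l2 := (lambda2 (laplacian R E)).

Lemma wlap_form_le_lambda_max p (X : 'M[R]_(N, p)) : 0 <= amax ->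
  mxdot (W *m X) X <= amax * lmax * mxdot X X.
Proof.
move=> amax_ge0; apply: (@le_trans _ _ (mxdot (wlap E (fun=> amax) *m X) X)).
  by apply: wlap_form_le => // e /alpha_bounds/andP[].
rewrite wlap_cst// -mulrA ler_wpM2l//; apply: rayleigh_le_lambda_max.
by rewrite laplacian_wlap wlap_sym.
Qed.

(** The operator inequality [W^2 >= d W] with [d = amin * l2]. Off the consensus part,
    [P >= d |Y|^2]; inserting this in [P^2 <= |W Y|^2 |Y|^2] and cancelling one [P] gives the
    claim. *)
Lemma wlap_norm_ge_lambda2 p (X : 'M[R]_(N, p)) :
  amin * l2 * mxdot (W *m X) X <= mxdot (W *m X) (W *m X).
Proof.
have [l2_gt0 l2_le] := laplacian_lambda2 R no_loop E_connected N_ge2.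
have d_gt0 : 0 < amin * l2 by rewrite mulr_gt0.
have N_neq0 : N%:R != 0 :> R by rewrite pnatr_eq0 -lt0n ltnW.
(* The mean of the rows; removing it changes neither [W X] nor the form. *)
pose m := N%:R^-1 *: (const_mx 1 *m X) : 'rV[R]_p.
pose Y := X - \matrix_(i < N) m.
have WY : W *m X = W *m Y by rewrite mulmxBr wlap_const// subr0.
have XY : mxdot (W *m X) X = mxdot (W *m Y) Y.
  rewrite -WY [in RHS]/Y mxdotBr [X in _ - X]mxdot_adjl wlap_sym wlap_const//.
  by rewrite mxdot0r subr0.
have Y0 : const_mx 1 *m Y = 0 :> 'rV_p.
  rewrite mulmxBr; apply/eqP; rewrite subr_eq0; apply/eqP/rowP => j.
  rewrite [RHS]mxE; under [RHS]eq_bigr => i _ do rewrite !mxE mul1r.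
  rewrite sumr_const card_ord -[RHS]mulr_natl mulVKf// mxE.
  by apply: eq_bigr => i _; rewrite mxE.
rewrite XY WY; set P := mxdot (W *m Y) Y.
have P_ge : amin * l2 * mxdot Y Y <= P.
  apply: (@le_trans _ _ (mxdot (wlap E (fun=> amin) *m Y) Y)).
    by rewrite wlap_cst// -mulrA ler_pM2l// l2_le.
  by apply: wlap_form_le => // e /alpha_bounds/andP[].
have cs := ip_cauchy_schwarz (mxdot_semi_inner R N p) (W *m Y) Y.
rewrite -/P in cs.
have P_ge0 : 0 <= P.
  by apply: le_trans P_ge; rewrite mulr_ge0 ?mxdot_ge0// ltW.
have [->|P_neq0] := eqVneq P 0; first by rewrite mulr0 mxdot_ge0.
have P_gt0 : 0 < P by rewrite lt_def P_neq0.
rewrite -(ler_pM2r P_gt0) -[leLHS]mulrA -expr2.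
apply: le_trans (ler_wpM2l (ltW d_gt0) cs) _.
by rewrite mulrCA ler_wpM2l ?mxdot_ge0.
Qed.

Variables (tau Tau q : R).
Hypotheses (tau_gt0 : 0 < tau) (Tau_gt0 : 0 < Tau) (q_bounds : 0 <= q < 1)
  (q_ge1 : amax * lmax / tau - 1 <= q) (q_ge2 : 1 - amin * l2 / Tau <= q)
  (c_ge0 : 0 <= amax * lmax) (amax_ge0 : 0 <= amax).
Variables (H : nat -> 'I_N -> 'M[R]_n) (X : nat -> 'M[R]_(N, n)).
Hypotheses (H_ge : forall k i, loewner_ge (H k i) tau%:M)
  (H_le : forall k i, loewner_ge Tau%:M (H k i))
  (XS : forall k i,
     row i (X k.+1) = row i (X k) - row i (W *m X k) *m invmx (H k i)).
Local Notation c := (amax * lmax).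
Local Notation K k := (rowwise (fun i => invmx (H k i))).

Let K_sym k (i : 'I_N) : (invmx (H k i))^T = invmx (H k i).
Proof. by rewrite trmx_inv (loewner_ge_sym (H_ge k i)). Qed.

Let W_lin p a (u v : 'M[R]_(N, p)) : W *m (a *: u + v) = a *: (W *m u) + W *m v.
Proof. by rewrite mulmxDr scalemxAr. Qed.

Let W_bounds p (u : 'M[R]_(N, p)) : 0 <= mxdot (W *m u) u <= c * mxdot u u.
Proof.
rewrite wlap_form_le_lambda_max// andbT wlap_form_ge0// => e /alpha_bounds.
by case/andP=> /(lt_le_trans amin_gt0)/ltW.
Qed.

Let W_sym p (u v : 'M[R]_(N, p)) : mxdot (W *m u) v = mxdot u (W *m v).
Proof. by rewrite mxdot_adjl wlap_sym. Qed.

Lemma newton_step k : X k.+1 = X k - K k (W *m X k).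
Proof. by apply/row_matrixP => i; rewrite XS linearB/= rowK. Qed.

Lemma disagreement_contraction k :
  mxdot (W *m X k.+1) (X k.+1) <= q ^+ 2 * mxdot (W *m X k) (X k).
Proof.
rewrite newton_step; have /andP[q_ge0 _] := q_bounds.
apply: (@ip_newton_contraction _ _ (@mxdot R N n) (mulmx W) (K k) c (amin * l2)
  tau Tau) => //.
- exact: mxdot_semi_inner.
- by move=> u v; apply/rowwise_sym/K_sym.
- by move=> a u v; apply: W_lin.
- by move=> a u v; apply: rowwise_lin.
- exact: wlap_norm_ge_lambda2.
- move=> u; rewrite rowwise_dot (mxdot_row u u) !mulr_sumr.
  have inv i := loewner_inv_bounds (row i u) tau_gt0 Tau_gt0
    (H_ge k i) (H_le k i).
  by apply/andP; split; apply: ler_sum => i _; have /andP[] := inv i.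
Qed.

Lemma disagreement_le k :
  mxdot (W *m X k) (X k) <= c * (q ^+ k * frob (X 0%N)) ^+ 2.
Proof.
have /andP[q_ge0 _] := q_bounds.
elim: k => [|k IHk].
  by rewrite mul1r sqr_frob; have /andP[] := W_bounds (X 0%N).
apply: le_trans (disagreement_contraction k) _.
apply: le_trans (ler_wpM2l (sqr_ge0 _) IHk) _.
by rewrite mulrCA -exprMn [q * (_ * _)]mulrA -exprS.
Qed.

Lemma disagreement_force_le k :
  frob (W *m X k) <= c * (q ^+ k * frob (X 0%N)).
Proof.
have /andP[q_ge0 _] := q_bounds.
have b_ge0 : 0 <= q ^+ k * frob (X 0%N).
  by rewrite mulr_ge0 ?exprn_ge0 ?frob_ge0.
rewrite frob_le; last exact: mulr_ge0 c_ge0 b_ge0.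
have := @ip_psd_norm _ _ (@mxdot R N n) (mulmx W) c (mxdot_semi_inner R N n)
  (@W_sym n) (@W_lin n) c_ge0 (@W_bounds n) (X k).
move/le_trans; apply; rewrite exprMn [c ^+ 2]expr2 -[leRHS]mulrA ler_wpM2l//.
exact: disagreement_le.
Qed.

Lemma newton_step_le k :
  frob (X k.+1 - X k) <= c / tau * frob (X 0%N) * q ^+ k.
Proof.
have KW : tau * frob (X k.+1 - X k) <= frob (W *m X k).
  rewrite -ler_sqr ?nnegrE ?mulr_ge0 ?frob_ge0 ?(ltW tau_gt0)//.
  rewrite exprMn !sqr_frob (mxdot_row (_ - _)) (mxdot_row (W *m _)) mulr_sumr.
  apply: ler_sum => i _; have uH := loewner_ge_unit tau_gt0 (H_ge k i).
  have -> : row i (X k.+1 - X k) = - (row i (W *m X k) *m invmx (H k i)).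
    by rewrite linearB/= XS addrAC subrr add0r.
  rewrite mxdotNl mxdotNr opprK.
  have := loewner_frob_ge (row i (W *m X k) *m invmx (H k i)) tau_gt0
    (H_ge k i).
  by rewrite mulmxKV.
have -> : c / tau * frob (X 0%N) * q ^+ k = c * (q ^+ k * frob (X 0%N)) / tau.
  by field; rewrite gt_eqF.
rewrite ler_pdivlMr// mulrC.
by apply: le_trans KW _; apply: disagreement_force_le.
Qed.

Lemma newton_consensus_rate : exists xt : 'rV[R]_n, forall k,
  frob (X k - \matrix_(i < N) xt) <=
    c / (tau * (1 - q)) * frob (X 0%N) * q ^+ k.
Proof.
have [l _ l_le] := geometric_steps_cvg q_bounds newton_step_le.
(* [X k] tends to [l] and [W *m X k] tends to 0, both geometrically; connectivity then makes all
   rows of [l] equal. *)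
have Wl : W *m l = 0.
  apply/eqP; rewrite -frob_eq0 -normr_le0 ger0_norm ?frob_ge0//.
  have /andP[q_ge0 q_lt1] := q_bounds.
  pose B := frob W * (c / tau * frob (X 0%N) / (1 - q)) + c * frob (X 0%N).
  have WB k : frob (W *m l) <= B * q ^+ k.
    have -> : W *m l = W *m X k - W *m (X k - l) by rewrite mulmxBr subKr.
    apply: le_trans (frobB _ _) _; rewrite mulrDl addrC lerD//.
      apply: le_trans (frob_mulmx _ _) _; rewrite -mulrA ler_wpM2l ?frob_ge0//.
    by have := disagreement_force_le k; rewrite [q ^+ k * _]mulrC mulrA.
  by apply: (cvgr_to_ge (geometric_cvg0 B q_bounds)); apply: nearW.
have i0 : 'I_N := Ordinal (ltnW N_ge2).
exists (row i0 l) => k.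
have -> : \matrix_(i < N) row i0 l = l.
  apply/row_matrixP => i; rewrite rowK.
  apply: (wlap_form0 no_loop E_connected (alpha := alpha)).
    by move=> e /alpha_bounds/andP[/(lt_le_trans amin_gt0)].
  by rewrite Wl mxdot0l.
apply: le_trans (l_le k) _; rewrite le_eqVlt; apply/orP; left; apply/eqP.
have /andP[_ q_lt1] := q_bounds.
by field; rewrite !gt_eqF// subr_gt0.
Qed.
End LinearConvergence.

(** * Consensus error *)

Section ConsensusError.
Variables (R : realType) (N n : nat).

Lemma mxdot_cvg (u v : nat -> 'rV[R]_n) (a b : 'rV[R]_n) :
  u k @[k --> \oo] --> a -> v k @[k --> \oo] --> b ->
  mxdot (u k) (v k) @[k --> \oo] --> mxdot a b.
Proof.
move=> ua vb; rewrite mxdotE; under eq_fun do rewrite mxdotE.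
apply: cvg_big => [|i _]; first exact: add_continuous.
apply: cvg_big => [|j _]; first exact: add_continuous.
exact: cvgM (cvg_comp _ _ ua (@coord_continuous R 1 n i j a))
  (cvg_comp _ _ vb (@coord_continuous R 1 n i j b)).
Qed.

Lemma gradient_cvg (f : 'rV[R]_n -> R) (x : nat -> 'rV[R]_n) (y : 'rV[R]_n) :
  (forall z, differentiable (gradient f) z) -> x k @[k --> \oo] --> y ->
  gradient f (x k) @[k --> \oo] --> gradient f y.
Proof.
by move=> dg xy; apply: (cvg_comp _ _ xy); apply: differentiable_continuous.
Qed.

Lemma bregman_lim_le (f : 'rV[R]_n -> R) (x : nat -> 'rV[R]_n)
    (y z : 'rV[R]_n) V :
  (forall p, differentiable f p) -> (forall p, differentiable (gradient f) p) ->
  x k @[k --> \oo] --> y -> (forall k, bregman f z (x k) <= V) ->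
  bregman f z y <= V.
Proof.
move=> df dg xy xV.
have cv : bregman f z (x k) @[k --> \oo] --> bregman f z y.
  rewrite /bregman dotpE; under eq_fun do rewrite dotpE.
  apply: cvgB; last first.
    apply: mxdot_cvg; first exact: gradient_cvg.
    by apply: cvgB => //; exact: cvg_cst.
  apply: cvgB; first exact: cvg_cst.
  exact: (cvg_comp _ _ xy (differentiable_continuous (df y))).
by apply: (cvgr_to_le cv); apply: nearW.
Qed.

Variables (f : 'I_N -> 'rV[R]_n -> R) (xstar xt : 'rV[R]_n).
Hypothesis dg : forall i x, differentiable (gradient (f i)) x.
Variables (X : nat -> 'M[R]_(N, n)) (L rho_ thb : 'I_N -> R).
Variables (V : nat -> R) (M V0 : R).
Hypotheses (grad_star : \sum_i gradient (f i) xstar = 0)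
  (grad_init : \sum_i gradient (f i) (row i (X 0%N)) = 0)
  (X_cvg : forall i, row i (X k) @[k --> \oo] --> xt)
  (taylor : forall k i, let D := row i (X k.+1 - X k) in
     frob (gradient (f i) (row i (X k.+1)) - gradient (f i) (row i (X k)) -
       D *m hessian (f i) (row i (X k))) <= L i / 2 * mxdot D D)
  (newton_sum0 : forall k,
     \sum_i row i (X k.+1 - X k) *m hessian (f i) (row i (X k)) = 0)
  (M_ge0 : 0 <= M) (L_le : forall i, L i <= M * rho_ i)
  (V_ge0 : forall k, 0 <= V k) (V_init : V 0%N <= V0)
  (V_decrease : forall k, V k.+1 + \sum_i rho_ i *
     mxdot (row i (X k.+1 - X k)) (row i (X k.+1 - X k)) <= V k).

(** The Newton terms cancel in the sum, leaving remainders of size [L i / 2 * |D|^2]. The constant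
    [M] trades [L i] for [rho_ i], after which the Lyapunov decrease telescopes. *)
Lemma gradient_drift k :
  frob (\sum_i gradient (f i) (row i (X k))) <= M / 2 * (V 0%N - V k).
Proof.
elim: k => [|k IHk]; first by rewrite grad_init frob0 subrr mulr0.
set G := \sum_i _ in IHk.
pose e i := gradient (f i) (row i (X k.+1)) - gradient (f i) (row i (X k)) -
  row i (X k.+1 - X k) *m hessian (f i) (row i (X k)).
have -> : \sum_i gradient (f i) (row i (X k.+1)) = \sum_(i in predT) e i + G.
  transitivity (\sum_i gradient (f i) (row i (X k.+1)) -
      \sum_i row i (X k.+1 - X k) *m hessian (f i) (row i (X k))).
    by rewrite newton_sum0 subr0.
  rewrite /G -big_split/= -sumrB.
  by apply: eq_bigr => i _; rewrite /e addrAC subrK.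
apply: le_trans (frobD _ _) _.
have e_le : frob (\sum_(i in predT) e i) <= M / 2 * (V k - V k.+1).
  apply: le_trans (frob_sum _ _) _.
  apply: (@le_trans _ _ (\sum_i M / 2 * (rho_ i *
      mxdot (row i (X k.+1 - X k)) (row i (X k.+1 - X k))))).
    apply: ler_sum => i _; apply: le_trans (taylor k i) _.
    by rewrite mulrA ler_wpM2r ?mxdot_ge0// mulrAC ler_pM2r.
  rewrite -mulr_sumr ler_wpM2l ?divr_ge0//.
  by rewrite lerBrDl.
apply: le_trans (lerD e_le IHk) _.
by rewrite -mulrDr addrC subrKA.
Qed.

Lemma consensus_gradient_le w :
  mxdot (\sum_i gradient (f i) xt) w <= M / 2 * V0 * frob w.
Proof.
have cv : mxdot (\sum_i gradient (f i) (row i (X k))) w @[k --> \oo] -->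
    mxdot (\sum_i gradient (f i) xt) w.
  apply: mxdot_cvg; last exact: cvg_cst.
  apply: cvg_big => [|i _]; first exact: add_continuous.
  exact: gradient_cvg.
apply: (cvgr_to_le cv); apply: nearW => k; apply: le_trans (mxdot_le _ _) _.
rewrite ler_wpM2r ?frob_ge0//; apply: le_trans (gradient_drift k) _.
apply: ler_wpM2l; first exact: divr_ge0.
by move: (V_ge0 k) V_init; lra.
Qed.

Lemma consensus_error :
  (forall i, thb i * mxdot (xt - xstar) (xt - xstar) <=
     mxdot (gradient (f i) xt - gradient (f i) xstar) (xt - xstar)) ->
  (\sum_i thb i) * frob (xt - xstar) <= M / 2 * V0.
Proof.
move=> strong; set w := xt - xstar in strong *.
have [->|w_neq0] := eqVneq (frob w) 0.
  by rewrite mulr0 mulr_ge0 ?divr_ge0// (le_trans (V_ge0 0%N)).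
have w_gt0 : 0 < frob w by rewrite lt_def w_neq0 frob_ge0.
rewrite -(ler_pM2r w_gt0) -[leLHS]mulrA -expr2 sqr_frob.
apply: le_trans (consensus_gradient_le w).
have -> : \sum_i gradient (f i) xt =
    \sum_i (gradient (f i) xt - gradient (f i) xstar).
  by rewrite sumrB grad_star subr0.
rewrite mulr_suml.
rewrite (mxdot_suml predT (fun i => gradient (f i) xt - gradient (f i) xstar)).
exact: ler_sum.
Qed.
End ConsensusError.

(** * Stacked vectors and monotonicity of Loewner bounds *)

Section Stacking.
Variables (R : realType) (N n : nat).

Lemma enorm_stackB (z w : 'I_N -> 'rV[R]_n) :
  enorm (stack z - stack w) = frob (\matrix_(i < N) z i - \matrix_(i < N) w i).
Proof.
have zwE : \matrix_(i < N) (z i - w i) =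
    \matrix_(i < N) z i - \matrix_(i < N) w i.
  by apply/matrixP => i j; rewrite !mxE.
have -> : stack z - stack w = stack (fun i => z i - w i).
  by rewrite /stack zwE linearB.
by rewrite enormE frob_stack zwE.
Qed.

Lemma frob_const_rows (u : 'rV[R]_n) :
  frob (\matrix_(i < N) u) = Num.sqrt N%:R * frob u.
Proof.
rewrite /frob mxdot_row; under eq_bigr => i _ do rewrite rowK.
by rewrite sumr_const card_ord -[_ *+ N]mulr_natl sqrtrM.
Qed.

(** The squared norm of the sum [s] is the product of [W X] with the matrix whose rows all equal
    [s], and the symmetric [W] kills the latter. *)
Lemma sum_row_wlap (E : {set {set 'I_N}}) (alpha : {set 'I_N} -> R)
    (X : 'M[R]_(N, n)) : (forall i, link i i \notin E) ->
  \sum_i row i (wlap E alpha *m X) = 0.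
Proof.
move=> no_loop; set s := \sum_i _; apply/eqP.
rewrite -frob_eq0 -sqrf_eq0 sqr_frob {1}/s.
rewrite (mxdot_suml predT (fun i => row i (wlap E alpha *m X))).
have -> : \sum_(i in predT) mxdot (row i (wlap E alpha *m X)) s =
    mxdot (wlap E alpha *m X) (\matrix_(i < N) s).
  by rewrite mxdot_row; apply: eq_bigr => i _; rewrite rowK.
by rewrite mxdot_adjl wlap_sym wlap_const// mxdot0r.
Qed.

Lemma loewner_ge_weaken (H : 'M[R]_n) (tau tau' : R) : tau' <= tau ->
  loewner_ge H tau%:M -> loewner_ge H tau'%:M.
Proof.
move=> le_tau Hge; split.
  by rewrite linearB/= (loewner_ge_sym Hge) tr_scalar_mx.
move=> v; rewrite dotpE mulmxBr mxdotBl mul_mx_scalar mxdotZl subr_ge0.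
by apply: le_trans (loewner_ge_form v Hge); rewrite ler_wpM2r ?mxdot_ge0.
Qed.

Lemma loewner_le_weaken (H : 'M[R]_n) (Tau Tau' : R) : Tau <= Tau' ->
  loewner_ge Tau%:M H -> loewner_ge Tau'%:M H.
Proof.
move=> le_Tau [sym pos]; split.
  have -> : Tau'%:M - H = (Tau'%:M - Tau%:M) + (Tau%:M - H).
    by rewrite addrA subrK.
  by rewrite linearD/= sym linearB/= !tr_scalar_mx.
move=> v; rewrite dotpE mulmxBr mxdotBl mul_mx_scalar mxdotZl subr_ge0.
apply: le_trans (loewner_le_form v (conj sym pos)) _.
by rewrite ler_wpM2r ?mxdot_ge0.
Qed.
End Stacking.

(** * The convergence rate *)

Section Graph.
Variables (N : nat) (E : {set {set 'I_N}}).

Lemma links_no_loop :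
  (forall e, e \in E -> exists i j, i <> j /\ e = link i j) ->
  forall i, link i i \notin E.
Proof.
move=> E_links i; apply/negP => /E_links[a [b [ab /setP iE]]]; apply: ab.
have := iE a; have := iE b; rewrite !inE !eqxx !orbT /= !orbb.
by move=> /eqP -> /eqP ->.
Qed.

Lemma connected_nbrs_gt0 : (2 <= N)%N -> connected_graph E ->
  forall i, (0 < #|nbrs E i|)%N.
Proof.
move=> N_ge2 E_connected i.
have [j ji] : exists j, j != i.
  pose i0 : 'I_N := Ordinal (ltnW N_ge2); pose i1 : 'I_N := Ordinal N_ge2.
  have [->|ii0] := eqVneq i i0; last by exists i0; rewrite eq_sym.
  by exists i1.
have /connectP[[|k p] /=] := E_connected i j.
  by move=> _ ji'; rewrite ji' eqxx in ji.
by case/andP => ik _ _; apply/card_gt0P; exists k; rewrite inE.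
Qed.

Lemma ord_setT_neq0 : (2 <= N)%N -> [set: 'I_N]%SET != finset.set0.
Proof.
move=> /ltnW N_gt0; apply/finset.set0Pn.
by exists (Ordinal N_gt0); rewrite inE.
Qed.

Lemma links_neq0 : (2 <= N)%N -> connected_graph E -> E != finset.set0.
Proof.
move=> N_ge2 E_connected.
pose i : 'I_N := Ordinal (ltnW N_ge2).
have /card_gt0P[j] := connected_nbrs_gt0 N_ge2 E_connected i.
by rewrite inE => ij; apply/finset.set0Pn; exists (link i j).
Qed.
End Graph.

Section Rate.
Variable R : realType.

(** Since [d <= c], the two entries have a nonnegative sum, so their maximum is nonnegative and
    vanishes only if both do. *)
Lemma max_rate_bounds (c d : R) : 0 < d -> d <= c -> c < 2 ->
  0 <= Num.max (c - 1) (1 - d) < 1 /\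
  (Num.max (c - 1) (1 - d) = 0 -> c = 1 /\ d = 1).
Proof.
move=> d_gt0 dc c_lt2; set m := Num.max _ _.
have m1 : c - 1 <= m by rewrite le_max lexx.
have m2 : 1 - d <= m by rewrite le_max lexx orbT.
split; last by move=> m0; split; lra.
by rewrite /m gt_max; apply/andP; split; [rewrite -/m|apply/andP; split]; lra.
Qed.

Variables (N : nat) (E : {set {set 'I_N}}) (alpha : {set 'I_N} -> R).
Variables (tau Tau : R).
Hypotheses (N_ge2 : (2 <= N)%N) (no_loop : forall i, link i i \notin E)
  (E_connected : connected_graph E)
  (alpha_gt0 : forall e, e \in E -> 0 < alpha e)
  (tau_gt0 : 0 < tau) (tau_Tau : tau <= Tau)
  (alpha_lt : forall e, e \in E ->
     alpha e < tau / fmax [set: 'I_N]%SET (fun i => #|nbrs E i|%:R)).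
Local Notation lmax := (lambda_max (laplacian R E)).
Local Notation l2 := (lambda2 (laplacian R E)).

Lemma fmin_gt0 : 0 < fmin E alpha.
Proof.
have [[e eE ->] _] := fminP alpha (links_neq0 N_ge2 E_connected).
exact: alpha_gt0.
Qed.

Lemma fmin_fmax_bounds e : e \in E -> fmin E alpha <= alpha e <= fmax E alpha.
Proof.
have E_neq0 := links_neq0 N_ge2 E_connected => eE.
have [_ -> //] := fminP alpha E_neq0.
by have [_ ->] := fmaxP alpha E_neq0.
Qed.

Lemma fmin_le_fmax : fmin E alpha <= fmax E alpha.
Proof.
have [e eE] := finset.set0Pn _ (links_neq0 N_ge2 E_connected).
by have /andP[] := fmin_fmax_bounds eE; apply: le_trans.
Qed.

Lemma laplacian_lambda2_le_max : l2 <= lmax.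
Proof. by apply: lambda2_le_lambda_max; rewrite // laplacian_wlap wlap_sym. Qed.

Lemma laplacian_lambda2_gt0 : 0 < l2.
Proof. by have [] := laplacian_lambda2 R no_loop E_connected N_ge2. Qed.

Lemma laplacian_lambda_max_gt0 : 0 < lmax.
Proof. exact: lt_le_trans laplacian_lambda2_gt0 laplacian_lambda2_le_max. Qed.

(** The largest eigenvalue is at most twice the maximal degree, which is what turns the degree
    condition on [alpha] into [c / tau < 2], hence [c / tau - 1 < 1]. *)
Lemma alpha_lambda_max_lt : fmax E alpha * lmax < 2 * tau.
Proof.
have [[e eE aE] _] := fmaxP alpha (links_neq0 N_ge2 E_connected).
have := alpha_lt eE; rewrite -aE; set deg := fun i => #|nbrs E i|%:R : R.
have [[i _ dE] d_ge] := fmaxP deg (ord_setT_neq0 N_ge2).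
have d_gt0 : 0 < fmax [set: 'I_N]%SET deg.
  by rewrite dE ltr0n connected_nbrs_gt0.
have lmax_le : lmax <= 2 * fmax [set: 'I_N]%SET deg.
  apply: laplacian_lambda_max_le => //; first exact: ltnW.
  by move=> j; apply: d_ge; rewrite inE.
have a_ge0 : 0 <= fmax E alpha by rewrite aE ltW ?alpha_gt0.
rewrite ltr_pdivlMr// => a_lt.
by apply: le_lt_trans (ler_wpM2l a_ge0 lmax_le) _; rewrite mulrCA ltr_pM2l.
Qed.

(** The value 0 does occur: two linked nodes with Hessians constantly [tau%:M], [Tau = tau] and
    [alpha = tau / 2] reach consensus in one step. *)
Lemma rate_bounds : 0 <= rate E alpha tau Tau < 1 /\
  (rate E alpha tau Tau = 0 -> fmax E alpha * lmax = tau /\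
                               fmin E alpha * l2 = Tau).
Proof.
have Tau_gt0 : 0 < Tau by apply: lt_le_trans tau_Tau.
have d_gt0 : 0 < fmin E alpha * l2 / Tau.
  by rewrite divr_gt0 ?mulr_gt0 ?fmin_gt0 ?laplacian_lambda2_gt0.
have dc : fmin E alpha * l2 / Tau <= fmax E alpha * lmax / tau.
  apply: ler_pM; last by rewrite lef_pV2.
  - by apply/ltW/mulr_gt0; [exact: fmin_gt0 | exact: laplacian_lambda2_gt0].
  - by rewrite invr_ge0 ltW.
  - apply: ler_pM; rewrite ?fmin_le_fmax ?laplacian_lambda2_le_max//.
      exact/ltW/fmin_gt0.
    exact/ltW/laplacian_lambda2_gt0.
have c_lt2 : fmax E alpha * lmax / tau < 2.
  by rewrite ltr_pdivrMr// alpha_lambda_max_lt.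
have [q01 q0] := max_rate_bounds d_gt0 dc c_lt2; split=> // /q0[c1 d1].
by split; [rewrite -[RHS]mul1r -c1 | rewrite -[RHS]mul1r -d1];
   rewrite divfK// gt_eqF.
Qed.
End Rate.

Theorem theorem3 (R : realType) (N n : nat) (N_ge2 : (2 <= N)%N)
    (n_ge1 : (1 <= n)%N)
    (* network *)
    (E : {set {set 'I_N}})
    (E_links : forall e, e \in E -> exists i j, i <> j /\ e = link i j)
    (E_connected : connected_graph E)
    (* objectives, their minimizers and the optimal solution; (A1), (A3) *)
    (f : 'I_N -> 'rV[R]_n -> R)
    (xmin : 'I_N -> 'rV[R]_n) (xstar : 'rV[R]_n)
    (f_C2 : forall i, twice_continuously_differentiable (f i))
    (f_convex : forall i, locally_strongly_convex (f i))
    (f_min : forall i, is_minimizer (f i) (xmin i))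
    (f_lipschitz : forall i, locally_lipschitz_mx (hessian (f i)))
    (xstar_min : is_minimizer (fun x => \sum_i f i x) xstar)
    (f_coercive : forall i, coercive (bregman (f i) xstar))
    (* constants *)
    (V0 := lyapunov f xstar xmin)
    (C := sublevel f xstar V0)
    (Gam := fun _ : {set 'I_N} => 1 : R)
    (theta_ Theta_ L thetab Thetab theta' Theta' L' : 'I_N -> R)
    (abar : R)
    (theta_gt0 : forall i, 0 < theta_ i) (Theta_gt0 : forall i, 0 < Theta_ i)
    (theta_Theta : forall i,
       hessian_bounds (f i) (conv_hull (C i)) (theta_ i) (Theta_ i))
    (theta := fmin [set: 'I_N]%SET theta_)
    (Theta := fmax [set: 'I_N]%SET Theta_)
    (L_ge0 : forall i, 0 <= L i)
    (L_lip : forall i,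
       lipschitz_mx_on (conv_hull (C i)) (L i) (hessian (f i)))
    (thetab_gt0 : forall i, 0 < thetab i) (Thetab_gt0 : forall i, 0 < Thetab i)
    (thetab_Thetab : forall i,
       hessian_bounds (f i) (conv_hull (\bigcup_j C j)) (thetab i) (Thetab i))
    (abar_gt0 : 0 < abar)
    (C' := fun i => enlarge (C i) (delta E Gam theta_ abar V0 i))
    (theta'_gt0 : forall i, 0 < theta' i) (Theta'_gt0 : forall i, 0 < Theta' i)
    (theta'_Theta' : forall i, hessian_bounds (f i) (C' i) (theta' i) (Theta' i))
    (L'_ge0 : forall i, 0 <= L' i)
    (L'_lip : forall i, lipschitz_mx_on (C' i) (L' i) (hessian (f i)))
    (Theta'_ge : forall i, Theta_ i <= Theta' i)
    (theta'_le : forall i, theta' i <= theta_ i)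
    (L'_ge : forall i, L i <= L' i)
    (* DEAN iteration and step-size conditions *)
    (alpha : {set 'I_N} -> R)
    (alpha_abar : forall e, e \in E -> 0 < alpha e <= abar)
    (x : nat -> 'I_N -> 'rV[R]_n)
    (x_dean : dean_iteration E f alpha (fun _ y => 2^-1 * dotp y y) xmin x)
    (alpha_lt1 : forall i j, link i j \in E ->
       alpha (link i j) < 1 / (2 * Gam (link i j)) *
         Num.min (step_bound E theta_ theta' Theta' L' V0 i)
                 (step_bound E theta_ theta' Theta' L' V0 j))
    (alpha_lt2 : forall e, e \in E ->
       alpha e < theta / fmax [set: 'I_N]%SET (fun i => #|nbrs E i|%:R))
    (* conclusion *)
    (lmax := lambda_max (laplacian R E)) (l2 := lambda2 (laplacian R E))
    (q := rate E alpha theta Theta)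
    (rho_ := rho E alpha theta_ Theta_ L V0) :
  [/\ q < 1,
      (* q = 0 only occurs in the degenerate situation displayed here *)
      0 < q \/ [/\ q = 0, fmax E alpha * lmax = theta
                        & fmin E alpha * l2 = Theta],
      forall i, 0 < rho_ i
    & exists xt : 'rV[R]_n,
        (forall k, enorm (stack (x k) - stack (fun _ => xt))
           <= fmax E alpha * lmax / (theta * (1 - q))
              * enorm (stack (x 0%N)) * q ^+ k) /\
        enorm (stack (fun _ : 'I_N => xt) - stack (fun _ => xstar))
          <= fmax [set: 'I_N]%SET (fun i => L i / rho_ i)
             * (Num.sqrt N%:R * V0 / (2 * \sum_i thetab i))].
Proof.
have no_loop := links_no_loop E_links.
have nbrs_gt0 := connected_nbrs_gt0 N_ge2 E_connected.
have setT_neq0 := ord_setT_neq0 N_ge2.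
have [[i_th _ thE] th_le] := fminP theta_ setT_neq0.
have [[i_Th _ ThE] Th_ge] := fmaxP Theta_ setT_neq0.
rewrite -/theta in thE th_le; rewrite -/Theta in ThE Th_ge.
have th_gt0 : 0 < theta by rewrite thE.
have Th_gt0 : 0 < Theta by rewrite ThE.
have alpha_gt0 e : e \in E -> 0 < alpha e by move=> /alpha_abar/andP[].
have amin_gt0 := fmin_gt0 N_ge2 E_connected alpha_gt0.
have alpha_bounds := fmin_fmax_bounds alpha N_ge2 E_connected.
have amax_ge0 : 0 <= fmax E alpha.
  by apply: le_trans (fmin_le_fmax alpha N_ge2 E_connected); apply: ltW.
have df i y : differentiable (f i) y by have [] := f_C2 i.
have dg i y : differentiable (gradient (f i)) y by have [] := f_C2 i.
have V0_ge0 : 0 <= V0.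
  by apply: sumr_ge0 => i _; apply: (bregman_ge0 (df i) (dg i)).
have alpha_lt i j : link i j \in E -> alpha (link i j) <
    1 / (2 * 1) * step_bound E theta_ theta' Theta' L' V0 i.
  move=> /alpha_lt1; rewrite /Gam => /lt_le_trans; apply.
  by rewrite ler_pM2l// ge_min lexx.
have rho_gt0 i : 0 < rho_ i.
  exact: (rho_gt0 n_ge1 nbrs_gt0 V0_ge0 theta_gt0 theta'_gt0 theta'_Theta'
    L'_ge0 Theta'_ge theta'_le L'_ge alpha_abar alpha_lt).
have th_Th : theta <= Theta.
  have := Th_ge i_th; rewrite inE => /(_ erefl); apply: le_trans; rewrite thE.
  exact: (th_le_Th n_ge1 V0_ge0 theta_Theta).
have [q01 q0] := rate_bounds N_ge2 no_loop E_connected alpha_gt0 th_gt0 th_Th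
  alpha_lt2.
have /andP[q_ge0 q_lt1] := q01.
have q_ge1 : fmax E alpha * lmax / theta - 1 <= q by rewrite le_max lexx.
have q_ge2 : 1 - fmin E alpha * l2 / Theta <= q by rewrite le_max lexx orbT.
pose X k := \matrix_(i < N) x k i.
have rowX k i : row i (X k) = x k i by rewrite rowK.
have [x0E xSE] := x_dean.
have XS k i : row i (X k.+1) = row i (X k) -
    row i (wlap E alpha *m X k) *m invmx (hessian (f i) (row i (X k))).
  rewrite !rowX xSE row_wlap// -mulNmx -sumrN; congr (_ + _ *m _).
  by apply: eq_bigr => j _; rewrite !gradient_half_sqr !rowX -scalerN opprB.
have X0V : lyapunov f xstar (fun i => row i (X 0%N)) <= V0.
  rewrite le_eqVlt; apply/orP; left; apply/eqP.
  by apply: eq_bigr => i _; rewrite rowX x0E.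
have XC k i : C i (row i (X k)).
  exact: (orbit_mem n_ge1 no_loop nbrs_gt0 df dg f_convex V0_ge0 theta_gt0
    theta_Theta theta'_gt0 theta'_Theta' L'_ge0 L'_lip alpha_abar alpha_lt
    X0V XS).
have V_decrease := orbit_decrease n_ge1 no_loop nbrs_gt0 df dg f_convex V0_ge0
  theta_gt0 theta_Theta L_ge0 L_lip theta'_gt0 theta'_Theta' L'_ge0 L'_lip
  alpha_abar alpha_lt X0V XS.
have H_bounds k i : loewner_ge Theta%:M (hessian (f i) (row i (X k))) /\
    loewner_ge (hessian (f i) (row i (X k))) theta%:M.
  have [Hle Hge] := sublevel_hessian theta_Theta (XC k i).
  split; first by apply: loewner_le_weaken Hle; apply: Th_ge; rewrite inE.
  by apply: loewner_ge_weaken Hge; apply: th_le; rewrite inE.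
have c_ge0 : 0 <= fmax E alpha * lmax.
  exact/mulr_ge0/ltW/(laplacian_lambda_max_gt0 R N_ge2 no_loop E_connected).
have [xt rate_xt] := newton_consensus_rate N_ge2 no_loop E_connected amin_gt0
  alpha_bounds th_gt0 Th_gt0 q01 q_ge1 q_ge2 c_ge0 amax_ge0
  (fun k i => proj2 (H_bounds k i)) (fun k i => proj1 (H_bounds k i)) XS.
have row_cvg i : row i (X k) @[k --> \oo] --> xt.
  apply: frob_cvg (geometric_cvg0 _ q01) => k; apply: le_trans (rate_xt k).
  by apply: le_trans (frob_row_le _ i); rewrite linearB/= rowK.
split=> //.
  have [qz|q_neq0] := eqVneq q 0; first by right; have [cE dE] := q0 qz.
  by left; rewrite lt_def q_neq0.
exists xt; split=> [k|].
  rewrite enorm_stackB enormE frob_stack; exact: rate_xt.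
(* Sublevel sets are closed, so the limit stays in them; this places the segment from [xstar] to
   [xt] in the hull on which [thetab] is a lower bound. *)
have xtC i : C i xt.
  apply: (bregman_lim_le (df i) (dg i) (row_cvg i)) => k; exact: XC.
set M := fmax _ _.
have [[i_M _ ME] M_ge] := fmaxP (fun i => L i / rho_ i) setT_neq0.
rewrite -/M in ME M_ge.
have M_ge0 : 0 <= M by rewrite ME divr_ge0// ltW.
have L_le i : L i <= M * rho_ i by rewrite -ler_pdivrMr// M_ge// inE.
have grad_star : \sum_i gradient (f i) xstar = 0 by apply: sum_gradient_min.
have grad_init : \sum_i gradient (f i) (row i (X 0%N)) = 0.
  by apply: big1 => i _; rewrite rowX x0E gradient_min.
have newton_sum0 k :
    \sum_i row i (X k.+1 - X k) *m hessian (f i) (row i (X k)) = 0.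
  rewrite (eq_bigr (fun i => - row i (wlap E alpha *m X k))); last first.
    move=> i _.
    by rewrite (displacement_hessian theta_gt0 theta_Theta XS (XC k) erefl).
  by rewrite sumrN sum_row_wlap// oppr0.
have taylor k i : let D := row i (X k.+1 - X k) in
    frob (gradient (f i) (row i (X k.+1)) - gradient (f i) (row i (X k)) -
      D *m hessian (f i) (row i (X k))) <= L i / 2 * mxdot D D.
  move=> D; have DE : row i (X k.+1) = row i (X k) + D.
    by rewrite /D linearB/= addrC subrK.
  rewrite DE; apply: gradient_taylor => // t t01.
  have seg := conv_hull_segment t01 (conv_hull_sub (XC k i))
    (conv_hull_sub (XC k.+1 i)).
  have := L_lip i _ _ seg (conv_hull_sub (XC k i)).
  by rewrite DE [row i (X k) + D]addrC addrK [row i (X k) + _]addrC addrK.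
have V_ge0 k : 0 <= lyapunov f xstar (fun i => row i (X k)).
  by apply: sumr_ge0 => i _; apply: (bregman_ge0 (df i) (dg i)).
have strong i : thetab i * mxdot (xt - xstar) (xt - xstar) <=
    mxdot (gradient (f i) xt - gradient (f i) xstar) (xt - xstar).
  have := @gradient_diff_ge _ _ _ (dg i) xstar (xt - xstar) (thetab i).
  rewrite [xstar + (xt - xstar)]addrC subrK; apply => t t01.
  have seg : conv_hull (\bigcup_j C j) (xstar + t *: (xt - xstar)).
    apply: conv_hull_segment => //; apply: conv_hull_sub; exists i => //.
    exact: sublevel_xstar.
  by have [] := thetab_Thetab i _ seg.
have := consensus_error dg grad_star grad_init row_cvg taylor newton_sum0 M_ge0
  L_le V_ge0 X0V V_decrease strong.
have tb_gt0 : 0 < \sum_i thetab i.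
  rewrite (bigD1 i_th)//= ltr_wpDr ?thetab_gt0//.
  by apply: sumr_ge0 => i _; apply: ltW.
move=> err; rewrite enorm_stackB.
have -> : \matrix_(i < N) xt - \matrix_(i < N) xstar =
    \matrix_(i < N) (xt - xstar).
  by apply/matrixP => i j; rewrite !mxE.
rewrite frob_const_rows.
have -> : M * (Num.sqrt N%:R * V0 / (2 * \sum_i thetab i)) =
    Num.sqrt N%:R * (M / 2 * V0 / \sum_i thetab i).
  by field; rewrite gt_eqF.
by rewrite ler_wpM2l ?sqrtr_ge0// ler_pdivlMr// mulrC.
Qed.
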